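(* (Heron–Rota–Welsh Conjecture.) For any loopless matroid $\mathsf{M}$, the unsigned coefficients $\mu^0(\mathsf{M}),\dots,\mu^{\mathrm{rk}(\mathsf{M})}(\mathsf{M})$ of its characteristic polynomial form a unimodal and log-concave sequence of nonnegative integers: $$0\leq \mu^0(\mathsf{M})\leq \dots\leq \mu^k(\mathsf{M})\geq\cdots\geq\mu^{\mathrm{rk}(\mathsf{M})}(\mathsf{M})\geq 0\quad\text{for some } k\in\{0,\dots,\mathrm{rk}(\mathsf{M})\},$$ and $$\mu^k(\mathsf{M})^2\geq\mu^{k-1}(\mathsf{M})\,\mu^{k+1}(\mathsf{M})\quad\text{for every } k\in\{1,\dots,\mathrm{rk}(\mathsf{M})-1\}.$$
   Context: A (loopless) matroid $\mathsf{M}=(E,\mathcal{L})$ is a finite set $E$ with a collection $\mathcal{L}\subseteq 2^E$ of flats such that: $\emptyset\in\mathcal{L}$; $\mathcal L$ is closed under pairwise intersection; and for $F\in\mathcal{L}$, every element of $E\setminus F$ lies in exactly one flat that is minimal among the flats strictly containing $F$. The closure $\mathrm{cl}(S)$ of $S\subseteq E$ is the smallest flat containing $S$; $I\subseteq E$ is independent if $\mathrm{cl}(I_1)\subsetneq\mathrm{cl}(I_2)$ for all $I_1\subsetneq I_2\subseteq I$; the rank $\mathrm{rk}(S)$ is the maximal size of an independent subset of $S$, and $\mathrm{rk}(\mathsf{M})=\mathrm{rk}(E)$. The characteristic polynomial of $\mathsf{M}$ is $$\chi_{\mathsf{M}}(\lambda)=\sum_{S\subseteq E}(-1)^{|S|}\lambda^{\mathrm{rk}(\mathsf{M})-\mathrm{rk}(S)},$$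 and its unsigned coefficients $\mu^a(\mathsf{M})$ are defined by $$\chi_{\mathsf{M}}(\lambda)=\sum_{a=0}^{\mathrm{rk}(\mathsf{M})}(-1)^a\mu^a(\mathsf{M})\lambda^{\mathrm{rk}(\mathsf{M})-a}.$$ *)

(* Defs.v *)
From HB Require Import structures.
From mathcomp Require Import all_boot all_order all_algebra.

Set Implicit Arguments.
Unset Strict Implicit.
Unset Printing Implicit Defensive.

Import Order.TTheory GRing.Theory Num.Theory.
Local Open Scope ring_scope.

(* [covers L F G]: G is minimal among the members of L strictly containing F. *)
Definition covers (E : finType) (L : {set {set E}}) (F G : {set E}) : bool :=
  minset [pred H : {set E} | (H \in L) && (F \proper H)] G.

(* Looplessness is the axiom that the empty set is a flat. The ground set may
   be empty. *)
Record matroid (E : finType) := Matroid {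
  flats : {set {set E}};
  flats0 : set0 \in flats;
  flatsI : forall F G, F \in flats -> G \in flats -> F :&: G \in flats;
  flats_cover : forall (F : {set E}) (x : E), F \in flats -> x \notin F ->
    exists! G : {set E}, covers flats F G /\ x \in G
}.

(* The intersection of all flats containing S; it is the smallest one by
   [cl_flat], [sub_cl] and [cl_min] below. *)
Definition cl (E : finType) (M : matroid E) (S : {set E}) : {set E} :=
  \bigcap_(F in flats M | S \subset F) F.

Definition independent (E : finType) (M : matroid E) (I : {set E}) : bool :=
  [forall I1 : {set E}, forall I2 : {set E},
     (I1 \proper I2) && (I2 \subset I) ==> (cl M I1 \proper cl M I2)].

Definition rk (E : finType) (M : matroid E) (S : {set E}) : nat :=
  \max_(I : {set E} | independent M I && (I \subset S)) #|I|.

Definition mrank (E : finType) (M : matroid E) : nat := rk M [set: E].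

(* The truncated subtraction is exact, by [rk_le]. *)
Definition charpoly (E : finType) (M : matroid E) : {poly int} :=
  \sum_(S : {set E}) (-1) ^+ #|S| *: 'X^(mrank M - rk M S).

(* Meaningful for a <= mrank M; [charpolyE] and [mu_uniq] say that these are
   the coefficients determined by
   charpoly M = \sum_(a <= mrank M) (-1)^a mu^a X^(mrank M - a). *)
Definition mu (E : finType) (M : matroid E) (a : nat) : int :=
  (-1) ^+ a * (charpoly M)`_(mrank M - a).

Section Facts.
Variables (E : finType) (M : matroid E).
Implicit Types (S F : {set E}).

Lemma flatsT : [set: E] \in flats M.
Proof.
have [F FL Fmax] : exists2 F, F \in flats M &
    forall G, G \in flats M -> (#|G| <= #|F|)%N.
  by case: (arg_maxnP (fun F : {set E} => #|F|) (flats0 M)) => F FL Fmax; exists F.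
suff -> : [set: E] = F by [].
apply/eqP; rewrite eq_sym -subTset; apply/subsetP => x _.
case: (boolP (x \in F)) => // xF.
have [G [[/minsetP[/andP[GL FG] _] _] _]] := flats_cover FL xF.
by have := Fmax _ GL; rewrite leqNgt (proper_card FG).
Qed.

Lemma cl_flat S : cl M S \in flats M.
Proof.
rewrite /cl; elim/big_ind: _ => [|F G FL GL|F /andP[]//]; first exact: flatsT.
exact: flatsI.
Qed.

Lemma sub_cl S : S \subset cl M S.
Proof. by apply/bigcapsP => F /andP[]. Qed.

Lemma cl_min S F : F \in flats M -> S \subset F -> cl M S \subset F.
Proof. by move=> FL SF; apply: bigcap_inf; rewrite FL. Qed.

Lemma rk_le S : (rk M S <= mrank M)%N.
Proof.
apply/bigmax_leqP => I /andP[iI _].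
by apply: (@leq_bigmax_cond _ _ (fun I : {set E} => #|I|)); rewrite iI subsetT.
Qed.

Lemma size_charpoly : (size (charpoly M) <= (mrank M).+1)%N.
Proof.
apply: (leq_trans (size_sum _ _ _)); apply/bigmax_leqP => S _.
by apply: (leq_trans (size_scale_leq _ _)); rewrite size_polyXn ltnS leq_subr.
Qed.

Lemma coef_sum_rev (c : nat -> int) (r a : nat) : (a <= r)%N ->
  (\sum_(b < r.+1) ((-1) ^+ b * c b) *: 'X^(r - b) : {poly int})`_(r - a)
    = (-1) ^+ a * c a.
Proof.
move=> ar; rewrite coef_sum (bigD1 (inord a)) //= inordK // big1 => [|b ba].
  by rewrite coefZ coefXn eqxx mulr1 addr0.
rewrite coefZ coefXn; case: eqP => [e|]; last by rewrite mulr0.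
case/eqP: ba; apply: val_inj; rewrite /= inordK //.
have br : (b <= r)%N by rewrite -ltnS.
by rewrite -(subKn br) -e subKn.
Qed.

Lemma charpolyE :
  charpoly M = \sum_(a < (mrank M).+1) ((-1) ^+ a * mu M a) *: 'X^(mrank M - a).
Proof.
apply/polyP => i; case: (leqP i (mrank M)) => [ir|ri].
  rewrite -{2}(subKn ir) coef_sum_rev ?leq_subr //.
  by rewrite /mu mulrA -expr2 sqrr_sign mul1r subKn.
rewrite nth_default; last exact: leq_trans size_charpoly ri.
rewrite coef_sum big1 // => a _; rewrite coefZ coefXn.
by rewrite gtn_eqF ?mulr0 // (leq_ltn_trans (leq_subr _ _) ri).
Qed.

Lemma mu_uniq (c : nat -> int) :
  charpoly M = \sum_(a < (mrank M).+1) ((-1) ^+ a * c a) *: 'X^(mrank M - a) ->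
  forall a, (a <= mrank M)%N -> c a = mu M a.
Proof.
move=> e a ar; rewrite /mu e coef_sum_rev //.
by rewrite mulrA -expr2 sqrr_sign mul1r.
Qed.

End Facts.

(* Main.v *)
Require Import Defs.
From mathcomp Require Import all_boot all_order all_algebra.
From mathcomp Require Import zify ring lra.

(* The proof follows Braenden and Leake. Attach to the fan of flags of proper flats
   the symmetric multilinear degree obtained by successively intersecting with
   piecewise linear functions: shift the function by a modular one so that it
   vanishes on the current flag, and sum over the flags with one more flat.
   By induction on the dimension, the quadratic form obtained by fixing all but
   two arguments at ample functions has one positive eigenvalue: the local forms
   on the links are hyperbolic, and a Perron-Frobenius argument on the connected
   graph of the link glues them. In dimension two this is a computation in an
   interval of rank 3 or in a product of two intervals of rank 2. The functions
   alpha = [e in F] and beta = [e notin F] are limits of ample ones, and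
   deg (beta^k alpha^(d - k)) is the sum of |mu(0, F)| over the flats F of rank k
   avoiding e, by the recursion of Weisner's theorem. This yields the
   log-concavity of the reduced characteristic polynomial, and multiplying by
   lambda - 1 preserves it. *)

Set Implicit Arguments.
Unset Strict Implicit.
Unset Printing Implicit Defensive.

Import Order.TTheory GRing.Theory Num.Theory.
Local Open Scope ring_scope.

(** No intersection ring is built; only the numbers [deg] are used, with two properties: they are
    symmetric, and they depend on each argument only modulo linear functions. Both come from the
    balancing condition, which is required only in codimension one. Over an ordered field there is
    no spectral theorem at hand, so having one positive eigenvalue is expressed by a test: some [w]
    has [Q w w > 0], and [Q x w = 0] forces [Q x x <= 0]. The gluing argument then uses only sums of
    squares and the solution of one linear system. The obstacle at the end is that alpha and beta
    are only nef, so that forms built from them may degenerate. The inequality sought is a closed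
    condition: it is proved after adding a small multiple of an ample function and recovered at 0,
    degrees being polynomial in the perturbation. This requires one ample function, which
    [crossing_pairs] provides for every matroid. *)

(** Fredholm alternative: by symmetry the columns of [cokermx N] lie in the kernel of [N], so [z] is
    orthogonal to them and belongs to the row space. *)
Lemma symmetric_solvable (F : fieldType) n (N : 'M[F]_n) (z : 'rV_n) :
  N^T = N -> (forall k : 'rV_n, k *m N = 0 -> z *m k^T = 0) ->
  exists x : 'rV_n, x *m N = z.
Proof.
move=> Nsym zker.
suff /submxP[x ->] : (z <= N)%MS by exists x.
rewrite submxE; apply/eqP/trmx_inj/row_matrixP => i.
rewrite trmx_mul row_mul trmx0 row0; apply: trmx_inj.
rewrite trmx_mul trmxK trmx0; apply: zker.
by rewrite -row_mul -{2}Nsym -trmx_mul mulmx_coker trmx0 row0.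
Qed.

(** * Hyperbolicity of a symmetric matrix through a weighted graph Laplacian *)

Section Hyperbolic.
Variables (R : realFieldType) (n : nat) (A : 'I_n -> 'I_n -> R) (w : 'I_n -> R).
Hypothesis A_sym : forall i j, A i j = A j i.
Hypothesis w_gt0 : forall i, 0 < w i.
Hypothesis A_ge0 : forall i j, i != j -> 0 <= A i j.

Let D i := \sum_j A i j * w j.
Let N (x : 'I_n -> R) i := D i / w i * x i - \sum_j A i j * x j.

(** In the coordinates [x i / w i], [N] is the Laplacian of the graph with edge weights
    [A i j * w i * w j]. The diagonal of [A], which may be negative, cancels between the two parts
    of [N]. *)
Lemma laplacian_sos (x : 'I_n -> R) :
  (\sum_i x i * N x i) *+ 2 =
  \sum_i \sum_j A i j * w i * w j * (x i / w i - x j / w j) ^+ 2.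
Proof.
have w0 i : w i != 0 by rewrite gt_eqF.
have -> : \sum_i x i * N x i =
    \sum_i \sum_j A i j * (w j / w i * x i ^+ 2 - x i * x j).
  apply: eq_bigr => i _; rewrite /N /D !mulr_suml -sumrB mulr_sumr.
  by apply: eq_bigr => j _; field; rewrite w0.
rewrite mulr2n {2}exchange_big /= -big_split /=; apply: eq_bigr => i _.
rewrite -big_split /=; apply: eq_bigr => j _.
by rewrite (A_sym j i); field; rewrite !w0.
Qed.

Lemma laplacian_sos_ge0 (x : 'I_n -> R) i j :
  0 <= A i j * w i * w j * (x i / w i - x j / w j) ^+ 2.
Proof.
case: (eqVneq i j) => [->|ij]; first by rewrite subrr expr0n mulr0.
by rewrite mulr_ge0 ?sqr_ge0 // !mulr_ge0 ?A_ge0 // ltW.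
Qed.

Lemma laplacian_psd (x : 'I_n -> R) : 0 <= \sum_i x i * N x i.
Proof.
suff : 0 <= (\sum_i x i * N x i) *+ 2 by rewrite mulr2n; lra.
rewrite laplacian_sos; apply: sumr_ge0 => i _; apply: sumr_ge0 => j _.
exact: laplacian_sos_ge0.
Qed.

Hypothesis A_connected : forall f : 'I_n -> R,
  (forall i j, i != j -> 0 < A i j -> f i = f j) -> forall i j, f i = f j.

(** The uniqueness part of Perron-Frobenius: a vanishing sum of squares makes [x i / w i] constant
    along the edges with [A i j > 0], and the graph is connected. *)
Lemma laplacian_ker (x : 'I_n -> R) :
  (forall i, N x i = 0) -> forall i j, x i / w i = x j / w j.
Proof.
move=> Nx0; apply: A_connected => i j ij Aij.
have := laplacian_sos x.
rewrite big1 => [|k _]; last by rewrite Nx0 mulr0.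
rewrite mul0rn => /esym/eqP.
rewrite psumr_eq0 => [|k _]; last first.
  by apply: sumr_ge0 => l _; apply: laplacian_sos_ge0.
move/allP=> /(_ i (mem_index_enum _)) /=.
rewrite psumr_eq0 => [|l _]; last exact: laplacian_sos_ge0.
move/allP=> /(_ j (mem_index_enum _)) /=.
rewrite mulf_eq0 sqrf_eq0 subr_eq0 gt_eqF /=; last by rewrite !mulr_gt0.
by move/eqP.
Qed.

Hypothesis D_gt0 : forall i, 0 < D i.
Hypothesis A_square : forall x : 'I_n -> R,
  \sum_i \sum_j A i j * x i * x j <=
  \sum_i w i / D i * (\sum_j A i j * x j) ^+ 2.

(* On the complement of [w], the Laplacian [N = D - A] is invertible; solving
   [N x = D y] turns [A_square] for [x] into the bound on [y], the missing
   inequality being the positivity of [N] at [x - y]. *)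
Lemma hyperbolic_of_square (y : 'I_n -> R) :
  \sum_i D i * y i = 0 -> \sum_i \sum_j A i j * y i * y j <= 0.
Proof.
move=> Dy.
have w0 i : w i != 0 by rewrite gt_eqF.
have D0 i : D i != 0 by rewrite gt_eqF.
pose NM : 'M[R]_n := \matrix_(i, j) ((D i / w i) *+ (i == j) - A i j).
have NME (x : 'rV_n) i : (x *m NM) 0 i = N (x 0) i.
  rewrite mxE /N.
  under eq_bigr do rewrite mxE mulrBr.
  rewrite sumrB (bigD1 i) //= eqxx big1 ?addr0 => [|j /negPf ->]; last by rewrite mulr0.
  by rewrite mulrC; congr (_ - _); apply: eq_bigr => j _; rewrite mulrC A_sym.
have NMsym : NM^T = NM.
  apply/matrixP => i j; rewrite !mxE A_sym eq_sym.
  by case: eqP => [->|].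
pose z : 'rV[R]_n := \row_i (D i / w i * y i).
(* By [laplacian_ker] the kernel of [N] lies in the line of [w], and [z] is orthogonal to [w]
   because [\sum_i D i * y i = 0]. *)
have [|x xN] := @symmetric_solvable _ _ NM z NMsym.
  move=> k kN; apply/matrixP => i0 j0; rewrite !ord1 !mxE.
  have /laplacian_ker kc : forall i, N (k 0) i = 0.
    by move=> i; rewrite -NME kN mxE.
  case: (pickP (fun _ : 'I_n => true)) => [i1 _|no]; last by rewrite big1 // => i; have := no i.
  rewrite (eq_bigr (fun i => (k 0 i1 / w i1) * (D i * y i))) => [|i _].
    by rewrite -mulr_sumr Dy mulr0.
  by rewrite (kc i1 i) !mxE; field.
have Nx i : N (x 0) i = D i / w i * y i by rewrite -NME xN mxE.
have Ax i : \sum_j A i j * x 0 j = D i / w i * (x 0 i - y i).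
  by rewrite mulrBr -Nx /N subKr.
have := A_square (x 0).
have -> : \sum_i \sum_j A i j * x 0 i * x 0 j =
    \sum_i D i / w i * (x 0 i - y i) * x 0 i.
  apply: eq_bigr => i _; rewrite -Ax mulr_suml; apply: eq_bigr => j _; ring.
have -> : \sum_i w i / D i * (\sum_j A i j * x 0 j) ^+ 2 =
    \sum_i D i / w i * (x 0 i - y i) ^+ 2.
  by apply: eq_bigr => i _; rewrite Ax; field; rewrite w0 D0.
(* Write [u = x - y], so that [A x = (D / w) u]. Then [A_square] gives
   [\sum_i D i / w i * u i * y i <= 0], and positivity of [N] at [u] bounds the form at [y] by this
   sum. *)
have := laplacian_psd (fun i => x 0 i - y i).
have -> : \sum_i (x 0 i - y i) * N (fun i => x 0 i - y i) i =
    \sum_i \sum_j A i j * (x 0 i - y i) * y j.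
  apply: eq_bigr => i _.
  have -> : N (fun i => x 0 i - y i) i = D i / w i * (x 0 i - y i) -
      (\sum_j A i j * x 0 j - \sum_j A i j * y j).
    by rewrite /N -sumrB; congr (_ - _); apply: eq_bigr => j _; rewrite mulrBr.
  rewrite Ax subKr mulr_sumr; apply: eq_bigr => j _; ring.
have -> : \sum_i \sum_j A i j * (x 0 i - y i) * y j =
   \sum_i D i / w i * (x 0 i - y i) * y i - \sum_i \sum_j A i j * y i * y j.
  rewrite exchange_big /= -[X in _ - X]exchange_big /= -sumrB.
  apply: eq_bigr => j _; rewrite -Ax mulr_suml -sumrB.
  by apply: eq_bigr => i _; rewrite (A_sym i j); ring.
have -> : \sum_i D i / w i * (x 0 i - y i) ^+ 2 =
  \sum_i D i / w i * (x 0 i - y i) * x 0 i - \sum_i D i / w i * (x 0 i - y i) * y i.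
  by rewrite -sumrB; apply: eq_bigr => i _; ring.
lra.
Qed.

End Hyperbolic.

(** * Degree of a balanced fan *)

Definition link (T : finType) (face : pred {set T}) (s : {set T}) (F : T) : bool :=
  (F \notin s) && face (F |: s).

Lemma lk_card (T : finType) (face : pred {set T}) s F :
  link face s F -> #|F |: s| = #|s|.+1.
Proof. by case/andP=> Fs _; rewrite cardsU1 Fs. Qed.

Lemma lk_sym_of (T : finType) (face : pred {set T}) :
  (forall s t : {set T}, face t -> s \subset t -> face s) -> forall s F G,
  link face s F && link face (F |: s) G = link face s G && link face (G |: s) F.
Proof.
move=> face_sub s.
suff imp F G : link face s F && link face (F |: s) G -> link face s G && link face (G |: s) F.
  by move=> F G; apply/idP/idP; apply: imp.
rewrite /link !inE !negb_or => /andP[/andP[Fs fF] /andP[/andP[GF Gs] fG]].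
rewrite Fs Gs eq_sym GF setUCA fG !andbT /=.
by apply: face_sub fG _; apply: setUS; apply: subsetUr.
Qed.

Definition scalef (R : pzRingType) (T : finType) (a : R) (u : {ffun T -> R}) :
  {ffun T -> R} := [ffun F => a * u F].
Infix "*!" := scalef (at level 40, left associativity).

Lemma scale1f (R : pzRingType) (T : finType) (u : {ffun T -> R}) : 1 *! u = u.
Proof. by apply/ffunP => F; rewrite ffunE mul1r. Qed.

Lemma scaleN1f (R : pzRingType) (T : finType) (u : {ffun T -> R}) : (-1) *! u = - u.
Proof. by apply/ffunP => F; rewrite !ffunE mulN1r. Qed.

Lemma scale0f (R : pzRingType) (T : finType) (u : {ffun T -> R}) : 0 *! u = 0.
Proof. by apply/ffunP => F; rewrite !ffunE mul0r. Qed.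

(* A simplicial fan up to its realization: [glin] are the piecewise linear
   functions, given by their values on the rays [T], which are globally linear;
   [dual s F] witnesses that the rays of [s] are linearly independent. *)
Record fan (R : realFieldType) (T : finType) := Fan {
  fdim : nat;
  face : pred {set T};
  glin : {ffun T -> R} -> Prop;
  dual : {set T} -> T -> {ffun T -> R};
  face_sub : forall s t : {set T}, face t -> s \subset t -> face s;
  glin0 : glin 0;
  glinD : forall a u v, glin u -> glin v -> glin (a *! u + v);
  glin_dual : forall s F, face s -> F \in s -> glin (dual s F);
  dualE : forall s F G, face s -> F \in s -> G \in s -> dual s F G = (G == F)%:R;
  fan_balanced : forall (s : {set T}) l, face s -> #|s|.+1 = fdim -> glin l ->
    {in s, forall F, l F = 0} -> \sum_(F | link face s F) l F = 0
}.

Section Degree.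
Variables (R : realFieldType) (T : finType) (X : fan R T).
Implicit Types (s : {set T}) (F G : T) (u v w l : {ffun T -> R}).
Implicit Types vs : seq {ffun T -> R}.

Notation d := (fdim X).
Notation lk := (link (face X)).

Lemma glinB u v : glin X u -> glin X v -> glin X (u - v).
Proof. by move=> lu lv; rewrite addrC -scaleN1f; apply: glinD. Qed.

Lemma glinZ a u : glin X u -> glin X (a *! u).
Proof. by move=> lu; rewrite -[_ *! _]addr0; apply: glinD lu (glin0 X). Qed.

Lemma glinN u : glin X u -> glin X (- u).
Proof. by move=> lu; rewrite -scaleN1f; apply: glinZ. Qed.

Lemma glin_add u v : glin X u -> glin X v -> glin X (u + v).
Proof. by move=> lu lv; rewrite -[u]scale1f; apply: glinD. Qed.

Lemma glin_sum (I : Type) (r : seq I) (P : pred I) (f : I -> {ffun T -> R}) :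
  (forall i, P i -> glin X (f i)) -> glin X (\sum_(i <- r | P i) f i).
Proof.
by move=> lf; elim/big_ind: _ => //; [apply: glin0 | apply: glin_add].
Qed.

Definition reduce s v : {ffun T -> R} := v - \sum_(G in s) v G *! dual X s G.

Lemma reduceE s v F :
  reduce s v F = v F - \sum_(G in s) v G * dual X s G F.
Proof. by rewrite !ffunE sum_ffunE; congr (_ - _); apply: eq_bigr => G _; rewrite ffunE. Qed.

Lemma reduce_linear s v : face X s -> glin X (v - reduce s v).
Proof.
by move=> fs; rewrite subKr; apply: glin_sum => G Gs; apply/glinZ/glin_dual.
Qed.

Lemma reduce0 s v : face X s -> {in s, forall F, reduce s v F = 0}.
Proof.
move=> fs F Fs; rewrite reduceE (bigD1 F) //= dualE // eqxx mulr1 big1 ?addr0 ?subrr //.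
by move=> G /andP[Gs GF]; rewrite dualE // eq_sym (negPf GF) mulr0.
Qed.

Lemma reduce_id s v : {in s, forall F, v F = 0} -> reduce s v = v.
Proof. by move=> v0; rewrite /reduce big1 ?subr0 // => G Gs; rewrite v0 ?scale0f. Qed.

Lemma reduceD s a u v : reduce s (a *! u + v) = a *! reduce s u + reduce s v.
Proof.
apply/ffunP => F; rewrite [RHS]ffunE [_ F in RHS]ffunE !reduceE.
rewrite mulrBr mulr_sumr addrACA -opprD !ffunE.
congr (_ - _); rewrite -big_split /=; apply: eq_bigr => G _.
by rewrite !ffunE; ring.
Qed.

(* The degree of the product of [vs] and of the rays of [s]; meaningful only
   for a face [s] with [#|s| + size vs = d]. *)
Fixpoint deg vs s : R :=
  if vs is v :: vs' then \sum_(F | lk s F) reduce s v F * deg vs' (F |: s) else 1.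

Lemma lk_face s F : lk s F -> face X (F |: s).
Proof. by case/andP. Qed.

Lemma lk_sym s F G : lk s F && lk (F |: s) G = lk s G && lk (G |: s) F.
Proof. exact: lk_sym_of (@face_sub _ _ X) s F G. Qed.

Lemma deg_lin vs s a u v :
  deg ((a *! u + v) :: vs) s = a * deg (u :: vs) s + deg (v :: vs) s.
Proof.
rewrite /= mulr_sumr -big_split /=; apply: eq_bigr => F _.
by rewrite reduceD !ffunE; ring.
Qed.

Lemma degD vs s u v : deg ((u + v) :: vs) s = deg (u :: vs) s + deg (v :: vs) s.
Proof. by rewrite -[u]scale1f deg_lin mul1r scale1f. Qed.

Lemma deg0 vs s : deg (0 :: vs) s = 0.
Proof. by have := degD vs s 0 0; rewrite addr0 => /eqP; rewrite -subr_eq subrr => /eqP. Qed.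

Lemma degZ vs s a u : deg ((a *! u) :: vs) s = a * deg (u :: vs) s.
Proof. by rewrite -[_ *! _]addr0 deg_lin deg0 addr0. Qed.

Lemma degB vs s u v : deg ((u - v) :: vs) s = deg (u :: vs) s - deg (v :: vs) s.
Proof. by rewrite degD -scaleN1f degZ mulN1r. Qed.

(** Vanishing on linear functions and symmetry are proved by one induction: exchanging the first two
    entries uses this property for the remaining ones and yields it for one entry more.
    [deg_reduced_of], [deg_cons2_of] and [deg_swap_of] therefore take it as a hypothesis. *)
Definition deg_kills_linear vs := forall s l, face X s -> (#|s| + (size vs).+1)%N = d ->
  glin X l -> deg (l :: vs) s = 0.

Lemma deg_reduced_of vs s u v : deg_kills_linear vs ->
  face X s -> (#|s| + (size vs).+1)%N = d -> glin X (u - v) ->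
  {in s, forall F, v F = 0} ->
  deg (u :: vs) s = \sum_(F | lk s F) v F * deg vs (F |: s).
Proof.
move=> kl fs sd luv v0.
have /eqP := kl s _ fs sd luv; rewrite degB subr_eq0 => /eqP ->.
by rewrite /= reduce_id.
Qed.

(** Once [v] is reduced on [s], reducing it on [F |: s] costs only one dual function, that of [F].
    This leaves a mixed sum, symmetric by exchanging the order in which [F] and [G] are added, and a
    diagonal sum symmetric in [u] and [v] as it stands. *)
Lemma deg_cons2_of vs s u v : deg_kills_linear vs ->
  face X s -> (#|s| + (size vs).+2)%N = d ->
  deg (u :: v :: vs) s =
  \sum_(F | lk s F) \sum_(G | lk (F |: s) G)
     reduce s u F * reduce s v G * deg vs (G |: (F |: s))
  - \sum_(F | lk s F) reduce s u F * reduce s v F *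
     \sum_(G | lk (F |: s) G) dual X (F |: s) F G * deg vs (G |: (F |: s)).
Proof.
move=> kl fs sd; have fs' := fs; rewrite [LHS]/= -sumrB; apply: eq_bigr => F lF.
have fF := lk_face lF; have Fs : F \in F |: s by apply: setU11.
rewrite -[\sum_(G | _) reduce _ _ G * _]/(deg (v :: vs) (F |: s)).
pose y := reduce s v - reduce s v F *! dual X (F |: s) F.
have {}fs := reduce0 v fs; have lr := reduce_linear v fs'.
move: (reduce s v) @y fs lr => r y r0 lr.
rewrite (@deg_reduced_of _ _ _ y) //; first last.
- move=> G GFs; rewrite !ffunE dualE //; case: eqP => [->|/eqP GF].
    by rewrite mulr1 subrr.
  rewrite mulr0 subr0 r0 //.
  by move: GFs; rewrite !inE (negPf GF).
- rewrite opprB addrCA; apply: glin_add => //.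
  exact/glinZ/glin_dual.
- by rewrite (lk_card lF) addSnnS.
rewrite !mulr_sumr -sumrB; apply: eq_bigr => G _.
by rewrite !ffunE /GRing.scale /=; ring.
Qed.

Lemma deg_swap_of vs s u v : deg_kills_linear vs ->
  face X s -> (#|s| + (size vs).+2)%N = d ->
  deg (u :: v :: vs) s = deg (v :: u :: vs) s.
Proof.
move=> kl fs sd; rewrite !deg_cons2_of //; congr (_ - _); last first.
  by apply: eq_bigr => F _; rewrite [X in X * _]mulrC.
rewrite (exchange_big_dep (lk s)) /=; last first.
  by move=> F G lF lG; have := lk_sym s F G; rewrite lF lG => /esym/andP[].
apply: eq_bigr => G lG; apply: eq_big => [F|F _].
  by rewrite lk_sym lG.
by rewrite setUCA [X in X * _]mulrC.
Qed.

(* Swapping moves the linear entry one level down. *)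
Lemma deg_linear vs : deg_kills_linear vs.
Proof.
elim: vs => [|v vs IH] s l fs sd ll.
  rewrite /=; under eq_bigr do rewrite mulr1.
  apply: (@fan_balanced _ _ X s) => //; first by rewrite -sd addn1.
    rewrite -[reduce s l](subKr l); apply: glinB => //; exact: reduce_linear.
  exact: reduce0.
rewrite deg_swap_of //= big1 // => F lF.
rewrite -[\sum_(G | _) _]/(deg (l :: vs) (F |: s)) IH ?mulr0 //.
  exact: lk_face.
by rewrite (lk_card lF) addSnnS.
Qed.

Lemma deg_reduced vs s u v :
  face X s -> (#|s| + (size vs).+1)%N = d -> glin X (u - v) ->
  {in s, forall F, v F = 0} ->
  deg (u :: vs) s = \sum_(F | lk s F) v F * deg vs (F |: s).
Proof. exact: deg_reduced_of (@deg_linear vs). Qed.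

Lemma deg_congr vs s u v :
  face X s -> (#|s| + (size vs).+1)%N = d -> glin X (u - v) ->
  deg (u :: vs) s = deg (v :: vs) s.
Proof.
move=> fs sd luv; apply/eqP; rewrite -subr_eq0 -degB; apply/eqP.
exact: deg_linear.
Qed.

Lemma deg_swap vs s u v :
  face X s -> (#|s| + (size vs).+2)%N = d ->
  deg (u :: v :: vs) s = deg (v :: u :: vs) s.
Proof. exact: deg_swap_of (@deg_linear vs). Qed.

Lemma deg_cons2 vs s u v : face X s -> (#|s| + (size vs).+2)%N = d ->
  deg (u :: v :: vs) s =
  \sum_(F | lk s F) \sum_(G | lk (F |: s) G)
     reduce s u F * reduce s v G * deg vs (G |: (F |: s))
  - \sum_(F | lk s F) reduce s u F * reduce s v F *
     \sum_(G | lk (F |: s) G) dual X (F |: s) F G * deg vs (G |: (F |: s)).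
Proof. exact: deg_cons2_of (@deg_linear vs). Qed.

Lemma deg_eq_tail vs vs' s u :
  (forall F, lk s F -> deg vs (F |: s) = deg vs' (F |: s)) ->
  deg (u :: vs) s = deg (u :: vs') s.
Proof. by move=> e; rewrite /=; apply: eq_bigr => F lF; rewrite e. Qed.

Lemma deg_move us v vs s : face X s -> (#|s| + (size us + size vs).+1)%N = d ->
  deg (us ++ v :: vs) s = deg (v :: us ++ vs) s.
Proof.
elim: us s => [//|u us IH] s fs sd.
rewrite cat_cons -[(u :: us) ++ vs]/(u :: (us ++ vs)) deg_swap //; last first.
  by rewrite size_cat.
apply: deg_eq_tail => F lF; rewrite IH //; first exact: lk_face.
by rewrite (lk_card lF) addSnnS.
Qed.

Definition ray F : {ffun T -> R} := [ffun G => (G == F)%:R].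

Lemma deg_ray vs s F : lk s F -> deg (ray F :: vs) s = deg vs (F |: s).
Proof.
move=> lF; rewrite /= reduce_id; last first.
  move=> G Gs; rewrite ffunE; case: eqP => // e.
  by case/andP: lF; rewrite -e Gs.
rewrite (bigD1 F) //= ffunE eqxx mul1r big1 ?addr0 // => G /andP[_ /negPf GF].
by rewrite ffunE GF mul0r.
Qed.

Lemma deg_ray_nonlink vs s F : ~~ lk s F -> F \notin s -> deg (ray F :: vs) s = 0.
Proof.
move=> nF Fs; rewrite /= reduce_id; last first.
  by move=> G Gs; rewrite ffunE; case: eqP => // e; rewrite -e Gs in Fs.
rewrite big1 // => G lG; rewrite ffunE; case: eqP => [e|]; last by rewrite mul0r.
by rewrite -e lG in nF.
Qed.

(** Convexity of a piecewise linear function, tested locally at each non-maximal cone. [ample] is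
    strict convexity. *)
Definition nef v := forall s, face X s -> (#|s| < d)%N -> exists u,
  [/\ glin X (v - u), {in s, forall F, u F = 0} & forall F, lk s F -> 0 <= u F].

Definition ample v := forall s, face X s -> (#|s| < d)%N -> exists u,
  [/\ glin X (v - u), {in s, forall F, u F = 0} & forall F, lk s F -> 0 < u F].

Lemma nef_ample v w e : nef v -> ample w -> 0 < e -> ample (v + e *! w).
Proof.
move=> nv aw e0 s fs sd.
have [u1 [l1 z1 p1]] := nv s fs sd; have [u2 [l2 z2 p2]] := aw s fs sd.
exists (u1 + e *! u2); split.
- have -> : v + e *! w - (u1 + e *! u2) = (v - u1) + e *! (w - u2).
    by apply/ffunP => F; rewrite !ffunE; ring.
  by apply: glin_add => //; apply: glinZ.
- by move=> F Fs; rewrite !ffunE z1 // z2 // mulr0 addr0.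
- by move=> F lF; rewrite !ffunE ltr_wpDl ?p1 // pmulr_rgt0 ?p2.
Qed.

Hypothesis link_nonempty : forall s, face X s -> (#|s| < d)%N -> exists F, lk s F.

Lemma deg_gt0 vs s : face X s -> (#|s| + size vs)%N = d -> {in vs, forall v, ample v} ->
  0 < deg vs s.
Proof.
elim: vs s => [|v vs IH] s fs sd av; first exact: ltr01.
have sd' : (#|s| < d)%N by rewrite -sd -addSnnS leq_addr.
have [u [lu u0 up]] := av v (mem_head _ _) s fs sd'.
rewrite (deg_reduced fs sd lu u0).
have pos F : lk s F -> 0 < u F * deg vs (F |: s).
  move=> lF; rewrite mulr_gt0 ?up ?IH ?lk_face ?(lk_card lF) //; first by rewrite addSnnS.
  by move=> x xv; apply: av; rewrite inE xv orbT.
have [F lF] := link_nonempty fs sd'.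
rewrite (bigD1 F) //= ltr_pwDl ?pos // sumr_ge0 // => G /andP[lG _].
exact/ltW/pos.
Qed.

End Degree.

(** * Symmetric forms with one positive direction *)

Section QuadraticForm.
Variables (R : realFieldType) (T : finType) (Q : {ffun T -> R} -> {ffun T -> R} -> R).
Hypothesis Q_sym : forall x y, Q x y = Q y x.
Hypothesis Q_lin : forall a x y z, Q (a *! x + y) z = a * Q x z + Q y z.

Lemma form_square_lin a b x y :
  Q (a *! x + b *! y) (a *! x + b *! y) =
  a ^+ 2 * Q x x + a * b * Q x y *+ 2 + b ^+ 2 * Q y y.
Proof.
have Q0 z : Q 0 z = 0.
  by have := Q_lin 1 0 0 z; rewrite scale1f addr0 mul1r => /eqP; rewrite -subr_eq subrr => /eqP.
have QZ c z t : Q (c *! z) t = c * Q z t by rewrite -[_ *! z]addr0 Q_lin Q0 addr0.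
rewrite Q_lin QZ ![Q _ (_ + _)]Q_sym !Q_lin !QZ (Q_sym y x).
by rewrite mulr2n; ring.
Qed.

Lemma form_orthogonal_lin a b x y z :
  Q (a *! x + b *! y) z = a * Q x z + b * Q y z.
Proof.
rewrite Q_lin; congr (_ + _).
have Q0 : Q 0 z = 0.
  by have := Q_lin 1 0 0 z; rewrite scale1f addr0 mul1r => /eqP; rewrite -subr_eq subrr => /eqP.
by rewrite -[_ *! y]addr0 Q_lin Q0 addr0.
Qed.

(** The hypothesis is applied to the projection of [x] to the complement of [w], multiplied by
    [Q w w] to avoid a division. *)
Lemma reverse_cauchy_schwarz w : 0 < Q w w ->
  (forall x, Q x w = 0 -> Q x x <= 0) -> forall x, Q x x * Q w w <= Q x w ^+ 2.
Proof.
move=> w0 neg x.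
have /neg : Q (Q w w *! x + (- Q x w) *! w) w = 0 by rewrite form_orthogonal_lin; ring.
rewrite form_square_lin.
have -> : Q w w ^+ 2 * Q x x + Q w w * - Q x w * Q x w *+ 2 + (- Q x w) ^+ 2 * Q w w =
  Q w w * (Q x x * Q w w - Q x w ^+ 2) by rewrite mulr2n; ring.
by rewrite pmulr_rle0 // subr_le0.
Qed.

(** The combination of [x] and [w] orthogonal to [v] has value [Q w v ^+ 2 * Q x x] plus a
    nonnegative multiple of [Q w w], since the cross term vanishes by [Q x w = 0]. *)
Lemma negative_complement_transfer v w : 0 < Q w v -> 0 < Q w w ->
  (forall x, Q x v = 0 -> Q x x <= 0) -> forall x, Q x w = 0 -> Q x x <= 0.
Proof.
move=> wv ww neg x xw.
have /neg : Q (Q w v *! x + (- Q x v) *! w) v = 0 by rewrite form_orthogonal_lin; ring.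
rewrite form_square_lin xw mulr0 mul0rn addr0 sqrrN => h.
have : Q w v ^+ 2 * Q x x <= 0.
  by apply: le_trans h; rewrite lerDl mulr_ge0 ?sqr_ge0 // ltW.
by rewrite pmulr_rle0 // exprn_gt0.
Qed.

End QuadraticForm.

(** * The Hodge-Riemann relation in degree one for a fan with connected links *)

Section HodgeRiemann.
Variables (R : realFieldType) (T : finType) (X : fan R T).
Implicit Types (s : {set T}) (F G : T) (u v w l : {ffun T -> R}).
Implicit Types vs : seq {ffun T -> R}.

Notation d := (fdim X).
Notation lk := (link (face X)).
Notation deg := (deg X).
Notation ample := (ample X).

Hypothesis link_nonempty : forall s, face X s -> (#|s| < d)%N -> exists F, lk s F.
Hypothesis link_connected : forall s, face X s -> (#|s| + 3 <= d)%N ->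
  forall f : T -> R, (forall F G, lk s F -> lk (F |: s) G -> f F = f G) ->
  forall F G, lk s F -> lk s G -> f F = f G.
Hypothesis surface_negative : forall s w x, face X s -> (#|s| + 2)%N = d -> ample w ->
  deg [:: x; w] s = 0 -> deg [:: x; x] s <= 0.

Lemma deg_sum_ray vs s (z : {ffun T -> R}) : {in s, forall F, z F = 0} ->
  deg (z :: vs) s = \sum_(i < #|lk s|) z (enum_val i) * deg (ray R (enum_val i) :: vs) s.
Proof.
move=> z0; rewrite /= reduce_id // -(@big_enum_val _ _ _ _ (lk s) (fun F => z F * deg (ray R F :: vs) s)).
by apply: eq_bigr => F lF; rewrite deg_ray.
Qed.

(** The equality case identifies the graph of positive off-diagonal entries with the adjacency graph
    of the link, so that [link_connected] provides the hypothesis [A_connected]. *)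
Lemma ray_pair_ge0 vs s F G : face X s -> (#|s| + (size vs).+2)%N = d ->
  {in vs, forall v, ample v} -> lk s F -> lk s G -> F != G ->
  0 <= deg (ray R F :: ray R G :: vs) s ?= iff ~~ lk (F |: s) G.
Proof.
move=> fs sd av lF lG FG; rewrite deg_ray //.
case: (boolP (lk (F |: s) G)) => l2.
  rewrite deg_ray // /=; apply/leifP; apply: deg_gt0 => //; first exact: lk_face l2.
  by rewrite (lk_card l2) (lk_card lF) !addSnnS.
rewrite deg_ray_nonlink //; last by rewrite !inE negb_or eq_sym FG; case/andP: lG.
exact/leif_refl.
Qed.

Lemma deg_swap12 vs s u v w : face X s -> (#|s| + (size vs).+3)%N = d ->
  deg (u :: v :: w :: vs) s = deg (u :: w :: v :: vs) s.
Proof.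
move=> fs sd; apply: deg_eq_tail => F lF; apply: deg_swap; first exact: lk_face lF.
by rewrite (lk_card lF) addSnnS.
Qed.

(* It suffices to take [w] to be the first entry [v] of the product. Writing
   [v] as a positive combination [u] of rays of the link, the forms on the links
   of these rays are hyperbolic by induction, and summing the corresponding
   reverse Cauchy-Schwarz inequalities gives the hypothesis [A_square] of
   [hyperbolic_of_square]. *)
Theorem hodge_riemann vs s w x : face X s -> (#|s| + (size vs).+2)%N = d ->
  {in vs, forall v, ample v} -> ample w ->
  deg (x :: w :: vs) s = 0 -> deg (x :: x :: vs) s <= 0.
Proof.
elim: vs s w x => [|v vs IH] s w x fs sd avs aw.
  by apply: surface_negative => //; rewrite addn2 -sd addn2.
have av : ample v by apply: avs; apply: mem_head.
have avs' : {in vs, forall v, ample v} by move=> y yvs; apply: avs; rewrite inE yvs orbT.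
have pos a b : ample a -> ample b -> 0 < deg (a :: b :: v :: vs) s.
  move=> aa ab; apply: deg_gt0 => // y; rewrite !inE.
  by case/or4P=> [/eqP->|/eqP->|/eqP->|/avs'].
apply: (@negative_complement_transfer _ _ (fun a b => deg (a :: b :: v :: vs) s)
  _ _ v w (pos _ _ aw av) (pos _ _ aw aw)) => [a b|a b c e|{}x xv].
- exact: deg_swap.
- exact: deg_lin.
have sd' : (#|s| < d)%N by rewrite -sd /=; lia.
have [u [lu u0 up]] := av s fs sd'.
pose n := #|lk s|; pose F_ (i : 'I_n) := enum_val i : T.
have lF i : lk s (F_ i) by apply: (enum_valP i).
have Fs i : F_ i \notin s by case/andP: (lF i).
pose A i j := deg (ray R (F_ i) :: ray R (F_ j) :: v :: vs) s.
have A_row (z : {ffun T -> R}) i : {in s, forall F, z F = 0} ->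
    \sum_j A i j * z (F_ j) = deg (ray R (F_ i) :: z :: v :: vs) s.
  move=> z0; rewrite deg_swap // (deg_sum_ray _ z0); apply: eq_bigr => j _.
  by rewrite mulrC /A deg_swap.
have D_E i : \sum_j A i j * u (F_ j) = deg (v :: v :: vs) (F_ i |: s).
  rewrite A_row // deg_swap // -(@deg_congr _ _ _ _ _ v u) // deg_swap // deg_ray //.
have D_gt0 i : 0 < \sum_j A i j * u (F_ j).
  rewrite D_E; apply: deg_gt0 => //; first exact: lk_face (lF i).
    by rewrite (lk_card (lF i)) addSnnS.
  by move=> y; rewrite !inE => /or3P[/eqP->|/eqP->|/avs'].
have neq i j : i != j -> F_ i != F_ j by rewrite (inj_eq enum_val_inj).
have A_sum (z : {ffun T -> R}) : {in s, forall F, z F = 0} ->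
    \sum_i \sum_j A i j * z (F_ i) * z (F_ j) = deg (z :: z :: v :: vs) s.
  move=> z0; rewrite (deg_sum_ray _ z0); apply: eq_bigr => i _.
  rewrite -A_row // mulr_sumr; apply: eq_bigr => j _; ring.
have x'0 := reduce0 x fs; have lx := reduce_linear x fs.
move: (reduce X s x) x'0 lx => y y0 lxy.
have -> : deg (x :: x :: v :: vs) s = deg (y :: y :: v :: vs) s.
  by rewrite (deg_congr (v := y)) // deg_swap // (deg_congr (v := y)).
rewrite -A_sum //.
apply: (@hyperbolic_of_square _ _ A (fun i => u (F_ i))) => //.
- by move=> i j; apply: deg_swap.
- by move=> i; apply: up.
- by move=> i j ij; apply: ray_pair_ge0 => //; apply: neq.
- move=> f fA i j.
  (* [f] is a function of indices; [g] carries it to the rays of the link, with value 0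
     elsewhere. *)
  pose g F := odflt 0 (omap f [pick i | F_ i == F]).
  have gE k : g (F_ k) = f k.
    rewrite /g; case: pickP => [k' /eqP /enum_val_inj -> //|/(_ k)].
    by rewrite eqxx.
  rewrite -!gE; apply: (link_connected fs); rewrite ?lF //.
    by rewrite -sd /=; lia.
  move=> F G lFF lGG.
  have lG : lk s G by have := lk_sym X s F G; rewrite lFF lGG => /esym/andP[].
  have FG : F != G by case/andP: lGG; rewrite !inE negb_or eq_sym => /andP[].
  have rank_of K : lk s K -> exists k, K = F_ k.
    by move=> lK; exists (enum_rank_in (lK : K \in lk s) K); rewrite /F_ enum_rankK_in.
  have [k eF] := rank_of _ lFF; have [k' eG] := rank_of _ lG.
  rewrite eF eG !gE; apply: fA.
    by apply: contraNneq FG => e; rewrite eF eG e.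
  rewrite lt0r [X in _ && X](ray_pair_ge0 (G := F_ k')) -?eF -?eG //.
  rewrite andbT eq_sym (ray_pair_ge0 (vs := v :: vs)) -?eF -?eG ?negbK //.
- move=> z0; cbv beta.
  pose z : {ffun T -> R} := [ffun F => odflt 0 (omap z0 [pick i | F_ i == F])].
  have zE k : z0 k = z (F_ k).
    rewrite ffunE; case: pickP => [k' /eqP /enum_val_inj -> //|/(_ k)].
    by rewrite eqxx.
  have zs : {in s, forall F, z F = 0}.
    move=> F Fin; rewrite ffunE; case: pickP => // k /eqP e.
    by have := Fs k; rewrite e Fin.
  under eq_bigr => i _ do under eq_bigr => j _ do rewrite !zE.
  (* Moving [v] to the front and replacing it by [u] writes the form at [z] as a combination, with
     the positive weights [u F], of the forms on the links of the rays [F]. *)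
  rewrite A_sum // deg_swap12 // deg_swap // (deg_reduced _ _ lu) //.
  have -> : \sum_(F | lk s F) u F * deg (z :: z :: vs) (F |: s) =
     \sum_(i < #|lk s|) u (F_ i) * deg (z :: z :: vs) (F_ i |: s).
    exact: (@big_enum_val _ _ _ _ (lk s) (fun F => u F * deg (z :: z :: vs) (F |: s))).
  apply: ler_sum => i _.
  have -> : \sum_j A i j * z0 j = \sum_j A i j * z (F_ j).
    by apply: eq_bigr => j _; rewrite zE.
  rewrite D_E A_row // deg_ray // -mulrA ler_pM2l ?up //.
  rewrite ler_pdivlMl; last by rewrite -D_E.
  rewrite mulrC.
  have fF := lk_face (lF i).
  have sdF : (#|F_ i |: s| + (size vs).+2)%N = d by rewrite (lk_card (lF i)) addSnnS.
  apply: (@reverse_cauchy_schwarz _ _ (fun a b => deg (a :: b :: vs) (F_ i |: s))) => //.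
  + by move=> a b; apply: deg_swap.
  + by move=> a b c e; apply: deg_lin.
  + by rewrite -D_E.
  + by move=> c cv; apply: (IH _ v).
- under eq_bigr => i _ do rewrite D_E.
  have -> : \sum_(i < n) deg (v :: v :: vs) (F_ i |: s) * y (F_ i) = deg (y :: v :: v :: vs) s.
    by rewrite (deg_sum_ray _ y0); apply: eq_bigr => i _; rewrite deg_ray // mulrC.
  by rewrite -xv; apply/esym/deg_congr.
Qed.

End HodgeRiemann.

(** * From ample to nef functions by polynomial perturbation *)

Lemma horner0_ge0 (R : realFieldType) (p : {poly R}) :
  (forall e, 0 < e -> 0 <= p.[e]) -> 0 <= p.[0].
Proof.
move=> pos; rewrite leNgt; apply/negP => p0.
have [q pE] : exists q : {poly R}, p = q * 'X + (p.[0])%:P.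
  have /factor_theorem[q] : root (p - (p.[0])%:P) 0 by rewrite /root !hornerE subrr.
  by rewrite subr0 => e; exists q; rewrite -e subrK.
have [b bq] := poly_disk_bound q 1.
have b0 : 0 <= b by apply: le_trans (normr_ge0 q.[0]) (bq 0 _); rewrite normr0.
have den : 0 < b + 1 - p.[0] by lra.
have [e [e0 e1 eE]] : exists e, [/\ 0 < e, e <= 1 & e * (b + 1 - p.[0]) = - p.[0]].
  (* As [e <= 1] gives [p.[e] <= b * e + p.[0]], this [e] turns the bound into [e * (p.[0] - 1)],
     which is negative. *)
  exists (- p.[0] / (b + 1 - p.[0])); split.
  - by rewrite divr_gt0 // oppr_gt0.
  - by rewrite ler_pdivrMr //; lra.
  - by rewrite divfK // gt_eqF.
have := pos e e0; rewrite pE !hornerE leNgt => /negP; apply.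
have qe : q.[e] <= b by apply: le_trans (ler_norm _) (bq _ _); rewrite gtr0_norm.
have : q.[e] * e <= b * e by rewrite ler_pM2r.
have : e * p.[0] < 0 by rewrite pmulr_rlt0.
move: eE; rewrite [b * e]mulrC mulrBr mulrDr mulr1; lra.
Qed.

Definition polynomial_fun (R : nzRingType) (f : R -> R) :=
  exists p : {poly R}, forall e, f e = p.[e].

Section PolynomialFun.
Variable R : comNzRingType.
Implicit Types f g : R -> R.

Lemma polynomial_fun_cst (c : R) : polynomial_fun (fun=> c).
Proof. by exists c%:P => e; rewrite hornerC. Qed.

Lemma polynomial_fun_id : polynomial_fun (fun e : R => e).
Proof. by exists 'X => e; rewrite hornerX. Qed.

Lemma polynomial_funD f g : polynomial_fun f -> polynomial_fun g ->
  polynomial_fun (fun e => f e + g e).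
Proof. by move=> [p pE] [q qE]; exists (p + q) => e; rewrite hornerD pE qE. Qed.

Lemma polynomial_funM f g : polynomial_fun f -> polynomial_fun g ->
  polynomial_fun (fun e => f e * g e).
Proof. by move=> [p pE] [q qE]; exists (p * q) => e; rewrite hornerM pE qE. Qed.

Lemma polynomial_fun_sum (I : Type) (r : seq I) (P : pred I) (f : I -> R -> R) :
  (forall i, polynomial_fun (f i)) -> polynomial_fun (fun e => \sum_(i <- r | P i) f i e).
Proof.
move=> pf; elim: r => [|i r [p pE]].
  by exists 0 => e; rewrite big_nil horner0.
have [q qE] := pf i; exists (if P i then q + p else p) => e.
by rewrite big_cons pE; case: ifP; rewrite ?hornerD ?qE.
Qed.

Lemma polynomial_fun_eq f g : f =1 g -> polynomial_fun f -> polynomial_fun g.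
Proof. by move=> e [p pE]; exists p => x; rewrite -e. Qed.

End PolynomialFun.

Section NefLogConcavity.
Variables (R : realFieldType) (T : finType) (X : fan R T).
Implicit Types (s : {set T}) (F G : T) (u v w : {ffun T -> R}).
Implicit Types vs : seq {ffun T -> R}.

Notation d := (fdim X).
Notation lk := (link (face X)).
Notation deg := (deg X).

Definition line_at (e : R) (uw : {ffun T -> R} * {ffun T -> R}) := uw.2 + e *! uw.1.

Lemma polynomial_fun_deg uws s :
  polynomial_fun (fun e => deg [seq line_at e uw | uw <- uws] s).
Proof.
elim: uws s => [|[u w] uws IH] s /=; first exact: polynomial_fun_cst.
apply: polynomial_fun_sum => F; apply: polynomial_funM => //.
have h : polynomial_fun (fun e => e * reduce X s u F + reduce X s w F).
  by apply: polynomial_funD; first apply: polynomial_funM;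
     [apply: polynomial_fun_id| |]; apply: polynomial_fun_cst.
apply: polynomial_fun_eq h => e.
by rewrite /line_at /= [w + _]addrC reduceD [RHS]ffunE [_ F in RHS]ffunE.
Qed.

Hypothesis link_nonempty : forall s, face X s -> (#|s| < d)%N -> exists F, lk s F.
Hypothesis link_connected : forall s, face X s -> (#|s| + 3 <= d)%N ->
  forall f : T -> R, (forall F G, lk s F -> lk (F |: s) G -> f F = f G) ->
  forall F G, lk s F -> lk s G -> f F = f G.
Hypothesis surface_negative : forall s w x, face X s -> (#|s| + 2)%N = d -> ample X w ->
  deg [:: x; w] s = 0 -> deg [:: x; x] s <= 0.

Theorem nef_log_concave g vs s u v : ample X g ->
  face X s -> (#|s| + (size vs).+2)%N = d ->
  {in vs, forall w, nef X w} -> nef X v ->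
  deg (u :: u :: vs) s * deg (v :: v :: vs) s <= deg (u :: v :: vs) s ^+ 2.
Proof.
move=> ag fs sd nvs nv.
(* [g] is the direction of the perturbation: it moves [v] and [vs] into the ample cone, while [u] is
   paired with the direction 0 and stays fixed. *)
pose pvs := [seq (g, w) | w <- vs].
have [p pE] := polynomial_fun_deg ((0, u) :: (0, u) :: pvs) s.
have [q qE] := polynomial_fun_deg ((g, v) :: (g, v) :: pvs) s.
have [r rE] := polynomial_fun_deg ((0, u) :: (g, v) :: pvs) s.
have scalef0 e : e *! (0 : {ffun T -> R}) = 0 by apply/ffunP => F; rewrite !ffunE mulr0.
have at0 w t : line_at 0 (w, t) = t by rewrite /line_at scale0f addr0.
have pvs0 : [seq line_at 0 uw | uw <- pvs] = vs.
  by rewrite -map_comp -[RHS]map_id; apply: eq_map => w /=; rewrite at0.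
have -> : deg (u :: u :: vs) s = p.[0] by rewrite -pE !map_cons pvs0 !at0.
have -> : deg (v :: v :: vs) s = q.[0] by rewrite -qE !map_cons pvs0 !at0.
have -> : deg (u :: v :: vs) s = r.[0] by rewrite -rE !map_cons pvs0 !at0.
suff : 0 <= (r ^+ 2 - p * q).[0] by rewrite hornerD hornerN horner_exp hornerM subr_ge0.
apply: horner0_ge0 => e e0; rewrite hornerD hornerN horner_exp hornerM subr_ge0 -pE -qE -rE !map_cons.
have -> : line_at e (0, u) = u by rewrite /line_at scalef0 addr0.
set vse := map _ _; set w := line_at e (g, v).
have size_vse : size vse = size vs by rewrite !size_map.
have aw : ample X w by apply: nef_ample.
have avse : {in vse, forall w, ample X w}.
  by move=> ? /mapP[_ /mapP[t tvs ->] ->]; apply: nef_ample => //; apply: nvs.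
apply: (@reverse_cauchy_schwarz _ _ (fun a b => deg (a :: b :: vse) s)).
- by move=> a b; apply: deg_swap; rewrite ?size_vse.
- by move=> a b c t; apply: deg_lin.
- apply: deg_gt0 => //; first by rewrite /= size_vse.
  by move=> t; rewrite !inE => /or3P[/eqP->|/eqP->|/avse].
- by move=> x; apply: hodge_riemann => //; rewrite size_vse.
Qed.

End NefLogConcavity.

(** * Rank and closure *)

Section MatroidRank.
Variables (E : finType) (M : matroid E).
Implicit Types (S I J F G H : {set E}) (x y : E).

Lemma cl_mono S S' : S \subset S' -> cl M S \subset cl M S'.
Proof. by move=> SS; apply: cl_min (cl_flat _ _) (subset_trans SS (sub_cl _ _)). Qed.

Lemma cl_id F : F \in flats M -> cl M F = F.
Proof. by move=> fF; apply/eqP; rewrite eqEsubset cl_min ?sub_cl. Qed.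

Lemma sub_cl_flat S F : F \in flats M -> (cl M S \subset F) = (S \subset F).
Proof.
move=> fF; apply/idP/idP => [|SF]; last exact: cl_min.
exact: subset_trans (sub_cl _ _).
Qed.

Lemma clK S : cl M (cl M S) = cl M S.
Proof. exact/cl_id/cl_flat. Qed.

Lemma cl_setU1_cl x S : cl M (x |: cl M S) = cl M (x |: S).
Proof.
apply/eqP; rewrite eqEsubset; apply/andP; split; last by apply/cl_mono/setUS/sub_cl.
rewrite sub_cl_flat ?cl_flat // subUset sub1set cl_mono ?subsetUr // andbT.
by apply: (subsetP (sub_cl _ _)); apply: setU11.
Qed.

Lemma cl0 : cl M set0 = set0.
Proof. exact/cl_id/flats0. Qed.

Lemma coversP F G : reflect
  [/\ G \in flats M, F \proper G &
    forall H, H \in flats M -> F \proper H -> H \subset G -> H = G]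
  (covers (flats M) F G).
Proof.
apply: (iffP minsetP) => [[/andP[fG FG] Gmin]|[fG FG Gmin]]; split=> //.
- by move=> H fH FH; apply: Gmin; apply/andP.
- by rewrite /= fG.
- by move=> H /andP[fH FH]; apply: Gmin.
Qed.

Lemma covers_cl F x : F \in flats M -> x \notin F -> covers (flats M) F (cl M (x |: F)).
Proof.
move=> fF xF; have [G [[cG xG] _]] := flats_cover fF xF.
have /coversP[fG FG Gmin] := cG.
suff -> : cl M (x |: F) = G by [].
apply: Gmin; first exact: cl_flat.
  apply: (@proper_sub_trans _ _ (x |: F)); last exact: sub_cl.
  by rewrite properE subsetUr subUset sub1set (negPf xF).
by rewrite sub_cl_flat // subUset sub1set xG proper_sub.
Qed.

Lemma covers_eq_cl F G x : covers (flats M) F G -> F \in flats M -> x \in G ->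
  x \notin F -> G = cl M (x |: F).
Proof.
move=> cG fF xG xF; have [K [_ Kuniq]] := flats_cover fF xF.
rewrite -(Kuniq G) //; apply: Kuniq; split; first exact: covers_cl.
by apply: (subsetP (sub_cl _ _)); apply: setU11.
Qed.

(** Both [cl M (x |: S)] and [cl M (y |: S)] are covers of [cl M S] containing [y], and the cover
    through [y] is unique. *)
Lemma cl_exchange S x y : y \in cl M (x |: S) -> y \notin cl M S -> x \in cl M (y |: S).
Proof.
move=> yx yS.
have xS : x \notin cl M S.
  apply: contra yS => xS; move: yx; rewrite -cl_setU1_cl.
  by rewrite (setUidPr _) ?sub1set // clK.
have c := covers_cl (cl_flat M S) xS.
rewrite cl_setU1_cl in c.
rewrite -cl_setU1_cl -(covers_eq_cl c (cl_flat _ _) yx yS).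
by apply: (subsetP (sub_cl _ _)); apply: setU11.
Qed.

Lemma independentP I : reflect (forall x, x \in I -> x \notin cl M (I :\ x))
  (independent M I).
Proof.
apply: (iffP idP) => [/forallP iI x xI|iI].
  have /forallP/(_ I) := iI (I :\ x).
  rewrite subxx andbT properD1 //= => /properP[_ [y yI yIx]].
  apply: contra yIx => xcl.
  by move: yI; rewrite -{1}(setD1K xI) -cl_setU1_cl (setUidPr _) ?sub1set // clK.
apply/forallP => I1; apply/forallP => I2; apply/implyP => /andP[/properP[I12 [x x2 x1]] I2I].
apply/properP; split; first exact: cl_mono.
exists x; first exact: subsetP (sub_cl _ _) _ x2.
apply: contra (iI x (subsetP I2I _ x2)); apply/subsetP/cl_mono.
apply/subsetP => y y1; rewrite !inE (subsetP I2I) ?(subsetP I12) // andbT.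
by apply: contraNneq x1 => <-.
Qed.

Lemma independent_sub I J : independent M J -> I \subset J -> independent M I.
Proof.
move=> /independentP iJ IJ; apply/independentP => x xI.
by apply: contra (iJ x (subsetP IJ _ xI)); apply/subsetP/cl_mono/setSD.
Qed.

Lemma independentU1 I x : independent M I -> x \notin cl M I -> independent M (x |: I).
Proof.
move=> iI xI; have xnI : x \notin I by apply: contra xI; apply/subsetP/sub_cl.
apply/independentP => y; rewrite !inE => /predU1P[->|yI]; first by rewrite setU1K.
have yx : y != x by apply: contraNneq xnI => <-.
have -> : (x |: I) :\ y = x |: (I :\ y).
  apply/setP => z; rewrite !inE; case: (eqVneq z x) => [->|]; last by [].
  by rewrite eq_sym yx.
apply: contra xI => yc.
rewrite -(setD1K yI); apply: cl_exchange yc _.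
exact: (independentP _ iI).
Qed.

(** Steinitz exchange: some [x] in [J :\: I] is replaced by a [y] in [I], which shrinks [J :\: I]
    and keeps [#|J|]. *)
Lemma independent_card_le I J : independent M I -> independent M J ->
  J \subset cl M I -> (#|J| <= #|I|)%N.
Proof.
move=> iI; have [k] := ubnP #|J :\: I|; elim: k => // k IH in J *.
rewrite ltnS => Jk iJ JI.
case: (set_0Vmem (J :\: I)) => [e|[x]].
  by apply: subset_leq_card; rewrite -setD_eq0 e.
rewrite inE => /andP[xI xJ].
(* If [I] were contained in [cl M (J :\ x)], so would be its closure, which contains [x]. *)
have [y yI yJ] : exists2 y, y \in I & y \notin cl M (J :\ x).
  apply/subsetPn; apply/negP => h; have /negP := independentP _ iJ x xJ; apply.
  apply: subsetP (subsetP JI x xJ); by rewrite sub_cl_flat ?cl_flat.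
have yJx : y \notin J :\ x by apply: contra yJ; apply/subsetP/sub_cl.
have cJ : #|J| = #|y |: (J :\ x)| by rewrite cardsU1 yJx (cardsD1 x) xJ.
rewrite cJ; apply: IH.
- apply: leq_trans Jk; apply: proper_card; apply/properP; split.
    apply/subsetP => z; rewrite !inE => /andP[zI /predU1P[e|/andP[_ ->]]].
      by rewrite e yI in zI.
    by rewrite zI.
  by exists x; rewrite !inE xI ?xJ // eqxx orbF; apply: contraNneq xI => ->.
- by apply: independentU1 => //; apply: independent_sub iJ (subsetDl _ _).
- rewrite subUset sub1set (subsetP (sub_cl M I)) //=.
  exact: subset_trans (subsetDl _ _) JI.
Qed.

Lemma independent0 : independent M set0.
Proof. by apply/independentP => x; rewrite inE. Qed.

Lemma rk_basis S : exists I, [/\ independent M I, I \subset S, cl M I = cl M S & rk M S = #|I|].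
Proof.
have : independent M set0 && (set0 \subset S) by rewrite independent0 sub0set.
case/(@arg_maxnP _ set0 (fun I => independent M I && (I \subset S)) (fun I => #|I|)).
move=> I /andP[iI IS] Imax; exists I.
have SI : S \subset cl M I.
  apply/subsetP => x xS; apply/negPn/negP => xI.
  have := Imax (x |: I); rewrite independentU1 // subUset sub1set xS IS => /(_ isT).
  rewrite cardsU1; have -> : x \notin I by apply: contra xI; apply/subsetP/sub_cl.
  by rewrite /= add1n ltnn.
split=> //.
  by apply/eqP; rewrite eqEsubset cl_mono // sub_cl_flat ?cl_flat.
apply/eqP; rewrite eqn_leq; apply/andP; split.
  by apply/bigmax_leqP => J /andP[iJ JS]; apply: Imax; rewrite iJ.
by apply: (@leq_bigmax_cond _ _ (fun I : {set E} => #|I|)); rewrite iI IS.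
Qed.

Lemma rk_independent_cl I S : independent M I -> cl M I = cl M S -> rk M S = #|I|.
Proof.
move=> iI IS; have [J [iJ JS JcS ->]] := rk_basis S.
apply/eqP; rewrite eqn_leq !independent_card_le //.
  by rewrite JcS -IS sub_cl.
by rewrite IS -JcS sub_cl.
Qed.

Lemma rk_cl S : rk M (cl M S) = rk M S.
Proof.
have [I [iI IS IcS ->]] := rk_basis S.
by apply: rk_independent_cl; rewrite // clK.
Qed.

Lemma rk0 : rk M set0 = 0%N.
Proof. by rewrite (rk_independent_cl independent0) ?cards0. Qed.

Lemma rk_setU1 F x : F \in flats M -> x \notin F -> rk M (x |: F) = (rk M F).+1.
Proof.
move=> fF xF; have [I [iI IF IcF ->]] := rk_basis F.
rewrite (cl_id fF) in IcF.
rewrite (@rk_independent_cl (x |: I)); first last.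
- by rewrite -[in LHS]cl_setU1_cl IcF.
- by apply: independentU1; rewrite ?IcF.
by rewrite cardsU1; have -> : x \notin I by apply: contra xF; apply/subsetP.
Qed.

Lemma rk_mono S S' : S \subset S' -> (rk M S <= rk M S')%N.
Proof.
move=> SS; apply/bigmax_leqP => I /andP[iI IS].
apply: (@leq_bigmax_cond _ _ (fun I : {set E} => #|I|)); rewrite iI.
exact: subset_trans SS.
Qed.

Lemma rk_proper F S : F \in flats M -> F \proper S -> (rk M F < rk M S)%N.
Proof.
move=> fF /properP[FS [x xS xF]]; rewrite -(rk_setU1 fF xF) rk_mono //.
by rewrite subUset sub1set xS.
Qed.

Lemma flat_eq_rk F G : F \in flats M -> F \subset G -> (rk M G <= rk M F)%N -> F = G.
Proof.
move=> fF FG rGF; apply/eqP; rewrite eqEproper FG /=; apply/negP => /rk_proper.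
by move/(_ fF); rewrite ltnNge rGF.
Qed.

Lemma flat_eq_cl F G x : F \in flats M -> G \in flats M -> F \subset G ->
  x \in G -> x \notin F -> (rk M G <= (rk M F).+1)%N -> G = cl M (x |: F).
Proof.
move=> fF fG FG xG xF r; apply/esym; apply: flat_eq_rk; first exact: cl_flat.
  by rewrite sub_cl_flat // subUset sub1set xG.
by rewrite rk_cl rk_setU1.
Qed.

Lemma cl_setU1_sub F G x : G \in flats M -> F \subset G -> x \in G -> cl M (x |: F) \subset G.
Proof. by move=> fG FG xG; rewrite sub_cl_flat // subUset sub1set xG. Qed.

Lemma rk_cl_setU1 F x : F \in flats M -> x \notin F -> rk M (cl M (x |: F)) = (rk M F).+1.
Proof. by move=> fF xF; rewrite rk_cl rk_setU1. Qed.

Lemma mem_cl_setU1 S x : x \in cl M (x |: S).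
Proof. by apply: (subsetP (sub_cl _ _)); apply: setU11. Qed.

Lemma sub_cl_setU1 S x : S \subset cl M (x |: S).
Proof. exact: subset_trans (subsetUr _ _) (sub_cl _ _). Qed.

(** Take a largest flat [G] inside [F] avoiding [x]. If some [y] of [F] were outside
    [cl M (x |: G)], then by exchange the larger flat [cl M (y |: G)] would still avoid [x]. *)
Lemma exists_corank1_avoiding F x : F \in flats M -> x \in F ->
  exists G, [/\ G \in flats M, G \subset F, x \notin G & rk M F = (rk M G).+1].
Proof.
move=> fF xF.
have : [&& set0 \in flats M, set0 \subset F & x \notin set0].
  by rewrite flats0 sub0set inE.
case/(@arg_maxnP _ set0 (fun G => [&& G \in flats M, G \subset F & x \notin G]) (fun G => #|G|)).
move=> G /and3P[fG GF xG] Gmax; exists G; split=> //.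
suff -> : F = cl M (x |: G) by rewrite rk_cl_setU1.
apply/eqP; rewrite eqEsubset cl_setU1_sub // andbT.
apply/subsetP => y yF; apply/negPn/negP => yc.
have yG : y \notin G by apply: contra yc; apply/subsetP/sub_cl_setU1.
have := Gmax (cl M (y |: G)); rewrite cl_flat cl_setU1_sub //=.
have -> /= : x \notin cl M (y |: G).
  by apply: contra yc => xy; apply: cl_exchange xy _; rewrite cl_id.
move=> /(_ isT); rewrite leqNgt => /negP; apply; apply: proper_card.
by apply/properP; split; [apply: sub_cl_setU1 | exists y; rewrite ?mem_cl_setU1].
Qed.

End MatroidRank.

(** * The Bergman fan *)

Section Flags.
Variables (E : finType) (M : matroid E).
Implicit Types (S F G H P Q : {set E}) (x y a b : E) (s t : {set {set E}}).

Definition flag_dim := (mrank M).-1.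
Notation d := flag_dim.

Definition proper_flat F := [&& F \in flats M, F != set0 & F != setT].

Definition flag s := [forall F in s, proper_flat F] &&
  [forall F in s, forall G in s, (F \subset G) || (G \subset F)].

Notation lk := (link flag).

Lemma flagP s : reflect
  ({in s, forall F, proper_flat F} /\ {in s &, forall F G, (F \subset G) || (G \subset F)})
  (flag s).
Proof.
apply: (iffP andP) => -[].
  move=> /forall_inP h1 /forall_inP h2; split=> // F G Fs Gs.
  by have /forall_inP := h2 F Fs; apply.
move=> h1 h2; split; first exact/forall_inP.
by apply/forall_inP => F Fs; apply/forall_inP => G Gs; apply: h2.
Qed.

Lemma flag_sub s t : flag t -> s \subset t -> flag s.
Proof.
move=> /flagP[h1 h2] st; apply/flagP; split=> [F Fs|F G Fs Gs].
  by apply: h1; apply: (subsetP st).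
by apply: h2; apply: (subsetP st).
Qed.

Lemma flag0 : flag set0.
Proof. by apply/flagP; split=> F; rewrite inE. Qed.

Lemma flag_flat s F : flag s -> F \in s -> F \in flats M.
Proof. by move=> /flagP[h _] /h /and3P[]. Qed.

Lemma proper_flat_rk F : proper_flat F -> (0 < rk M F <= d)%N.
Proof.
move=> /and3P[fF F0 FT]; apply/andP; split.
  by rewrite -(rk0 M) rk_proper ?flats0 // properEneq eq_sym F0 sub0set.
have : (rk M F < mrank M)%N by rewrite rk_proper // properEneq FT subsetT.
by rewrite /d; case: (mrank M).
Qed.

Lemma proper_flat_between F P Q : F \in flats M -> P \proper F -> F \proper Q -> proper_flat F.
Proof.
move=> fF PF FQ; rewrite /proper_flat fF /=; apply/andP; split.
  by apply: contraTneq PF => ->; rewrite properE sub0set andbF.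
by apply: contraTneq FQ => ->; rewrite properE subsetT andbF.
Qed.

Lemma flag_comparable s F G : flag s -> F \in s -> G \in s -> (F \subset G) || (G \subset F).
Proof. by move=> /flagP[_ h]; apply: h. Qed.

Lemma flag_sub_rk s F G : flag s -> F \in s -> G \in s ->
  (F \subset G) = (rk M F <= rk M G)%N.
Proof.
move=> fs Fs Gs; apply/idP/idP => [|r]; first exact: rk_mono.
case/orP: (flag_comparable fs Fs Gs) => // GF.
by rewrite (flat_eq_rk (flag_flat fs Gs) GF r).
Qed.

(** Take [x] in [G] outside the flat of [s] just below [G], if there is one. Together with the point
    of [flag_outer_point] it gives a linear function equal to 1 at [G] and to 0 on the rest of the
    flag. *)
Lemma flag_inner_point s G : flag s -> G \in s ->
  exists2 x, x \in G & forall H, H \in s -> x \in H -> G \subset H.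
Proof.
move=> fs Gs; pose U H := (H == set0) || (H \in s) && (H \proper G).
have [] := @arg_maxnP _ set0 U (fun H => #|H|); first by rewrite /U eqxx.
move=> H0 H0U H0max.
have H0G : H0 \proper G.
  case/orP: H0U => [/eqP->|/andP[] //]; rewrite proper0.
  by have /flagP[/(_ G Gs) /and3P[]] := fs.
have /properP[_ [x xG xH0]] := H0G; exists x => // H Hs xH.
case/orP: (flag_comparable fs Gs Hs) => // HG.
have [->|HnG] := eqVneq H G; first exact: subxx.
have HU : U H by rewrite /U Hs properEneq HnG HG orbT.
case/negP: xH0; case/orP: H0U => [/eqP e|/andP[H0s _]].
  have : (#|H| <= #|H0|)%N := H0max H HU.
  by rewrite e cards0 leqn0 cards_eq0 => /eqP e'; rewrite e' inE in xH.
case/orP: (flag_comparable fs H0s Hs) => [H0H|/subsetP->//].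
have /eqP -> : H0 == H by rewrite eqEcard H0H; apply: H0max.
by [].
Qed.

Lemma flag_outer_point s G : flag s -> G \in s ->
  exists2 x, x \notin G & forall H, H \in s -> G \proper H -> x \in H.
Proof.
move=> fs Gs; pose U H := (H == setT) || (H \in s) && (G \proper H).
have [] := @arg_minnP _ setT U (fun H => #|H|); first by rewrite /U eqxx.
move=> H0 H0U H0min.
have GH0 : G \proper H0.
  case/orP: H0U => [/eqP->|/andP[] //]; rewrite properT.
  by have /flagP[/(_ G Gs) /and3P[]] := fs.
have /properP[_ [x xH0 xG]] := GH0; exists x => // H Hs GH.
have HU : U H by rewrite /U Hs GH orbT.
case/orP: H0U => [/eqP e|/andP[H0s _]].
  have := H0min H HU; rewrite e => c.
  by have /eqP -> : H == setT by rewrite eqEcard subsetT.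
case/orP: (flag_comparable fs H0s Hs) => [/subsetP->//|HH0].
by have /eqP -> : H == H0 by rewrite eqEcard HH0; apply: H0min.
Qed.

Lemma lkP s F : flag s -> reflect
  [/\ F \notin s, proper_flat F & {in s, forall H, (F \subset H) || (H \subset F)}]
  (lk s F).
Proof.
move=> fs; apply: (iffP andP) => [[Fs fF]|[Fs pF cF]]; split=> //.
- by have /flagP[h _] := fF; apply: h; apply: setU11.
- by move=> H Hs; have /flagP[_ h] := fF; apply: h; rewrite ?setU11 // inE Hs orbT.
have /flagP[h1 h2] := fs.
apply/flagP; split=> [H|H K]; rewrite !inE.
  by move=> /predU1P[->|/h1].
move=> /predU1P[->|Hs] /predU1P[->|Ks].
- by rewrite subxx.
- exact: cF.
- by rewrite orbC cF.
- exact: h2.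
Qed.

Lemma lk_flat s F : flag s -> lk s F -> F \in flats M.
Proof. by move=> fs /(lkP _ fs)[_ /and3P[]]. Qed.

Lemma lk_pair s F G : flag s -> lk s F -> lk s G -> F != G ->
  lk (F |: s) G = (F \subset G) || (G \subset F).
Proof.
move=> fs lF lG FG; have [Gs pG cG] := lkP _ fs lG.
have fF : flag (F |: s) by case/andP: lF.
apply/idP/idP => [/(lkP _ fF)[_ _ /(_ F (setU11 _ _))]|c]; first by rewrite orbC.
apply/(lkP _ fF); split=> //; first by rewrite !inE negb_or eq_sym FG.
move=> H; rewrite !inE => /predU1P[->|]; first by rewrite orbC.
exact: cG.
Qed.

Lemma lk_rk_neq s F H : flag s -> lk s F -> H \in s -> rk M H != rk M F.
Proof.
move=> fs lF Hs; apply/eqP => e.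
have [Fs /and3P[fF _ _] /(_ H Hs) c] := lkP _ fs lF.
case/negP: Fs; case/orP: c => c.
  by rewrite (flat_eq_rk fF c) // e.
by rewrite -(flat_eq_rk (flag_flat fs Hs) c) // e.
Qed.

Lemma lk_rk_bound s F : flag s -> lk s F -> (0 < rk M F <= d)%N.
Proof. by move=> fs /(lkP _ fs)[_ /proper_flat_rk]. Qed.

Definition missing s (i : nat) := (0 < i <= d)%N && [forall H in s, rk M H != i].

Lemma lk_missing s F : flag s -> lk s F -> missing s (rk M F).
Proof.
move=> fs lF; rewrite /missing (lk_rk_bound fs lF); apply/forall_inP => H Hs.
exact: lk_rk_neq lF Hs.
Qed.

Definition missing_ranks s : {set 'I_d.+1} := [set i : 'I_d.+1 | missing s i].

(** Rank is injective on a flag, so the values in ['I_d.+1] split into 0, the ranks taken and the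
    ranks missing. The dimension of a link is thus a number of missing ranks. *)
Lemma flag_card_missing s : flag s -> (#|s| + #|missing_ranks s|)%N = d.
Proof.
move=> fs; have /flagP[pf _] := fs.
pose f H : 'I_d.+1 := inord (rk M H).
have fE H : H \in s -> f H = rk M H :> nat.
  by move=> /pf /proper_flat_rk /andP[_ h]; rewrite /f inordK.
have finj : {in s &, injective f}.
  move=> H K Hs Ks /(congr1 val) /=; rewrite !fE // => e.
  by apply/eqP; rewrite eqEsubset !(flag_sub_rk fs) // e leqnn.
have -> : missing_ranks s = ~: (ord0 |: f @: s).
  apply/setP => i; rewrite !inE negb_or -(inj_eq val_inj) /= /missing lt0n.
  rewrite -(ltnS i d) ltn_ord andbT; congr (_ && _).
  apply/forall_inP/idP => [h|h H Hs].
    by apply/imsetP => -[H Hs e]; have /eqP := h H Hs; apply; rewrite e fE.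
  apply: contra h => /eqP e; apply/imsetP; exists H => //; apply: val_inj.
  by rewrite /= fE.
have s0 : ord0 \notin f @: s.
  apply/imsetP => -[H Hs e]; have /andP[] := proper_flat_rk (pf H Hs).
  by rewrite -(fE H Hs) -e.
have := cardsC (ord0 |: f @: s).
by rewrite card_ord cardsU1 card_in_imset // s0 add1n addSn => -[].
Qed.

(** [P] and [Q] are consecutive in the chain [s] extended by [set0] and [setT]; the flats of the
    link lie in the open intervals of the gaps. *)
Definition gap s P Q := [/\ P \in flats M, Q \in flats M, P \proper Q,
  ((P == set0) || (P \in s)) /\ ((Q == setT) || (Q \in s)) &
  {in s, forall H, (H \subset P) || (Q \subset H)}].

Lemma gap_lk s P Q G : flag s -> gap s P Q -> G \in flats M -> P \proper G -> G \proper Q ->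
  lk s G.
Proof.
move=> fs [fP fQ PQ _ h] fG PG GQ; apply/(lkP _ fs); split.
- apply/negP => /h /orP[GP|QG].
    by have := proper_sub_trans PG GP; rewrite properxx.
  by have := proper_sub_trans GQ QG; rewrite properxx.
- exact: proper_flat_between PG GQ.
- move=> H /h /orP[HP|QH].
    by rewrite (subset_trans HP) ?orbT // proper_sub.
  by rewrite (subset_trans _ QH) // proper_sub.
Qed.

Lemma lk_gap_lower s P Q G : flag s -> gap s P Q -> lk s G -> (rk M P < rk M G)%N -> P \proper G.
Proof.
move=> fs [fP fQ PQ [P0 _] h] lG r.
have [Gs /and3P[fG G0 GT] c] := lkP _ fs lG.
case/orP: P0 => [/eqP->|/c /orP[/(rk_mono M)|PG]].
- by rewrite proper0.
- by rewrite leqNgt r.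
- by rewrite properEneq PG andbT; apply: contraTneq r => ->; rewrite ltnn.
Qed.

Lemma lk_gap_upper s P Q G : flag s -> gap s P Q -> lk s G -> (rk M G < rk M Q)%N -> G \proper Q.
Proof.
move=> fs [fP fQ PQ [_ QT] h] lG r.
have [Gs /and3P[fG G0 GT] c] := lkP _ fs lG.
case/orP: QT => [/eqP->|/c /orP[GQ|/(rk_mono M)]].
- by rewrite properT.
- by rewrite properEneq GQ andbT; apply: contraTneq r => ->; rewrite ltnn.
- by rewrite leqNgt r.
Qed.

Lemma missing_gap s j : flag s -> missing s j ->
  exists P Q, gap s P Q /\ (rk M P < j < rk M Q)%N.
Proof.
move=> fs /andP[/andP[j0 jd] /forall_inP js]; have /flagP[pf cf] := fs.
have d0 : (j < mrank M)%N by move: jd; rewrite /d; lia.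
pose L P := (P == set0) || (P \in s) && (rk M P < j)%N.
pose U Q := (Q == setT) || (Q \in s) && (j < rk M Q)%N.
have [] := @arg_maxnP _ set0 L (fun H => #|H|); first by rewrite /L eqxx.
move=> P PL Pmax.
have [] := @arg_minnP _ setT U (fun H => #|H|); first by rewrite /U eqxx.
move=> Q QU Qmin; exists P, Q.
have rP : (rk M P < j)%N by case/orP: PL => [/eqP->|/andP[]//]; rewrite rk0.
have rQ : (j < rk M Q)%N by case/orP: QU => [/eqP->|/andP[]//].
have fP : P \in flats M.
  by case/orP: PL => [/eqP->|/andP[/(flag_flat fs)]//]; apply: flats0.
have fQ : Q \in flats M.
  by case/orP: QU => [/eqP->|/andP[/(flag_flat fs)]//]; apply: flatsT.
split; last by rewrite rP.
have P' : (P == set0) || (P \in s) by case/orP: PL => [->//|/andP[->]]; rewrite orbT.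
have Q' : (Q == setT) || (Q \in s) by case/orP: QU => [->//|/andP[->]]; rewrite orbT.
split=> //.
  rewrite properEneq; apply/andP; split; first by apply: contraTneq rP => ->; rewrite -leqNgt ltnW.
  case/orP: P' => [/eqP->|Ps]; first exact: sub0set.
  case/orP: Q' => [/eqP->|Qs]; first exact: subsetT.
  by rewrite (flag_sub_rk fs) // ltnW // (ltn_trans rP).
move=> H Hs; have := js H Hs; rewrite neq_ltn => /orP[Hj|jH].
  have HL : L H by rewrite /L Hs Hj orbT.
  apply/orP; left; case/orP: P' => [/eqP e|Ps].
    have : (#|H| <= #|P|)%N := Pmax H HL.
    by rewrite e cards0 leqn0 cards_eq0 => /eqP->.
  case/orP: (cf H P Hs Ps) => // PH.
  by have /eqP <- : P == H by rewrite eqEcard PH; apply: Pmax.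
have HU : U H by rewrite /U Hs jH orbT.
apply/orP; right; case/orP: Q' => [/eqP e|Qs].
  by have := Qmin H HU; rewrite e => c; have /eqP -> : H == setT by rewrite eqEcard subsetT.
case/orP: (cf Q H Qs Hs) => // HQ.
by have /eqP <- : H == Q by rewrite eqEcard HQ; apply: Qmin.
Qed.

Lemma gap_missing s P Q i : flag s -> gap s P Q -> (rk M P < i < rk M Q)%N -> missing s i.
Proof.
move=> fs [fP fQ PQ [_ QT] h] /andP[Pi iQ]; rewrite /missing.
have -> : (0 < i <= d)%N.
  have := rk_le M Q; rewrite /d; lia.
apply/forall_inP => H /h /orP[/(rk_mono M)|/(rk_mono M)] r.
  by rewrite ltn_eqF // (leq_ltn_trans r).
by rewrite gtn_eqF // (leq_trans iQ).
Qed.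

Lemma gap_lower_not_missing s P Q : gap s P Q -> ~~ missing s (rk M P).
Proof.
move=> [fP fQ PQ [P0 _] h]; apply/negP => /andP[/andP[r0 _] /forall_inP js].
case/orP: P0 => [/eqP e|/js]; last by rewrite eqxx.
by rewrite e rk0 in r0.
Qed.

Lemma gap_upper_not_missing s P Q : gap s P Q -> ~~ missing s (rk M Q).
Proof.
move=> [fP fQ PQ [_ Q0] h]; apply/negP => /andP[/andP[r0 r1] /forall_inP js].
case/orP: Q0 => [/eqP e|/js]; last by rewrite eqxx.
by move: r0 r1; rewrite e /d -/(mrank M); lia.
Qed.

Lemma gap_atom_lk s P Q x : flag s -> gap s P Q -> x \in Q -> x \notin P ->
  ((rk M P).+1 < rk M Q)%N -> lk s (cl M (x |: P)).
Proof.
move=> fs gPQ xQ xP r; have [fP fQ PQ _ _] := gPQ.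
apply: (gap_lk fs gPQ); first exact: cl_flat.
  by apply/properP; split; [apply: sub_cl_setU1 | exists x; rewrite ?mem_cl_setU1].
rewrite properEneq cl_setU1_sub // ?(proper_sub PQ) // andbT.
by apply: contraTneq r => <-; rewrite rk_cl_setU1 // ltnn.
Qed.

Lemma flag_link_nonempty s : flag s -> (#|s| < d)%N -> exists F, lk s F.
Proof.
move=> fs sd; have := flag_card_missing fs.
have [->|/set0Pn[j]] := eqVneq (missing_ranks s) set0; first by rewrite cards0; lia.
rewrite inE => mj _; have [P [Q [g /andP[Pj jQ]]]] := missing_gap fs mj.
have [fP fQ /properP[_ [x xQ xP]] _ _] := g.
exists (cl M (x |: P)); apply: gap_atom_lk g _ _ _ => //.
exact: leq_ltn_trans jQ.
Qed.

(** Let [j] be the smallest missing rank, in the gap from [P] to [Q]. Each flat of the link contains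
    some [cl M (x |: P)] of rank [j] inside [Q] that is also in the link, so only these atoms have
    to be compared. *)
Lemma flag_link_connected (A : Type) s : flag s -> (#|s| + 3 <= d)%N ->
  forall f : {set E} -> A, (forall F G, lk s F -> lk (F |: s) G -> f F = f G) ->
  forall F G, lk s F -> lk s G -> f F = f G.
Proof.
move=> fs sd f fadj.
have fE F G : lk s F -> lk s G -> F \subset G -> f F = f G.
  move=> lF lG FG; have [->//|nFG] := eqVneq F G.
  by apply: fadj => //; rewrite lk_pair // FG.
have [j mj jmin] : exists2 j, missing s j & forall i, missing s i -> (j <= i)%N.
  have [F lF] : exists F, lk s F by apply: flag_link_nonempty => //; lia.
  have ex : exists i, missing s i by exists (rk M F); apply: lk_missing.
  by case: (ex_minnP ex) => j mj jmin; exists j.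
have [P [Q [g /andP[Pj jQ]]]] := missing_gap fs mj.
have [fP fQ PQ [_ QT] h] := g.
have {}Pj : j = (rk M P).+1.
  apply/eqP; rewrite eqn_leq Pj andbT; apply: jmin; apply: (gap_missing fs g).
  by rewrite ltnSn (leq_ltn_trans _ jQ).
have low F : lk s F -> exists p, [/\ lk s p, rk M p = j, p \subset Q & f F = f p].
  move=> lF; have PF : P \proper F.
    apply: (lk_gap_lower fs g lF); rewrite -Pj; apply: jmin; exact: lk_missing.
  have [Fs /and3P[fF _ _] c] := lkP _ fs lF.
  have [x xFQ xP] : exists2 x, x \in F :&: Q & x \notin P.
    have : P \proper F :&: Q.
      case/orP: QT => [/eqP->|/c /orP[/setIidPl->|/setIidPr->]] //; by rewrite setIT.
    by case/properP.
  move: xFQ; rewrite inE => /andP[xF xQ].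
  have lp : lk s (cl M (x |: P)) by apply: (gap_atom_lk fs g) => //; rewrite -Pj.
  exists (cl M (x |: P)); split=> //.
  - by rewrite rk_cl_setU1.
  - by rewrite cl_setU1_sub // proper_sub.
  - by apply/esym/fE; rewrite ?cl_setU1_sub // proper_sub.
suff atoms p p' : lk s p -> lk s p' -> rk M p = j -> rk M p' = j ->
    p \subset Q -> p' \subset Q -> f p = f p'.
  move=> F G lF lG; have [p [lp rp pQ ->]] := low F lF.
  by have [p' [lp' rp' p'Q ->]] := low G lG; apply: atoms.
move=> lp lp' rp rp' pQ p'Q.
have fp := lk_flat fs lp; have fp' := lk_flat fs lp'.
have Pp : P \proper p by apply: (lk_gap_lower fs g lp); rewrite rp Pj.
have Pp' : P \proper p' by apply: (lk_gap_lower fs g lp'); rewrite rp' Pj.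
have [->//|npp'] := eqVneq p p'.
have [x xp' xp] : exists2 x, x \in p' & x \notin p.
  apply/subsetPn; apply: contra npp' => p'p.
  by rewrite (flat_eq_rk fp' p'p) // rp rp'.
(* If the gap has room above [j], both atoms lie in the flat of rank [j.+1] that they span. *)
have [rQ|rQ] := ltnP j.+1 (rk M Q).
  pose l := cl M (x |: p).
  have Pl : P \proper l by apply: proper_sub_trans Pp _; apply: sub_cl_setU1.
  have lQ : l \proper Q.
    rewrite properEneq cl_setU1_sub ?(subsetP p'Q) // andbT.
    by apply: contraTneq rQ => <-; rewrite rk_cl_setU1 // rp ltnn.
  have ll : lk s l by apply: (gap_lk fs g); rewrite ?cl_flat.
  rewrite (fE p l) ?sub_cl_setU1 // (fE p' l) //.
  have xP : x \notin P by apply: contra xp; apply/subsetP/proper_sub.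
  have -> : p' = cl M (x |: P).
    by apply: flat_eq_cl => //; rewrite ?(proper_sub Pp') // rp' Pj.
  by apply/cl_mono/setUS/proper_sub.
(* Here the gap has only the rank [j]. The bound on [#|s|] leaves another missing rank, necessarily
   above [Q], and a flat [G] there contains [Q], hence both atoms. *)
have fps : flag (p |: s) by case/andP: lp.
have sd' : (#|p |: s| < d)%N by rewrite (lk_card lp) (leq_trans _ sd) // addn3 ltnS.
have [G lG'] := flag_link_nonempty fps sd'.
have [lG lpG] : lk s G /\ lk (G |: s) p.
  by have := lk_sym_of flag_sub s p G; rewrite lp lG' => /esym/andP[].
have npG : p != G by case/andP: lG'; rewrite !inE negb_or eq_sym => /andP[].
have jG : (j < rk M G)%N.
  rewrite ltn_neqAle jmin ?andbT; last exact: lk_missing.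
  by rewrite -rp; apply: (lk_rk_neq fps lG'); apply: setU11.
have {}rQ : rk M Q = j.+1 by apply/eqP; rewrite eqn_leq rQ.
have QG : Q \subset G.
  case/orP: QT => [/eqP eQ|Qs].
    have /andP[_] := lk_rk_bound fs lG; rewrite leqNgt => /negP[].
    by apply: leq_trans jG; rewrite /d /mrank -eQ rQ.
  have [Gs _ /(_ Q Qs) /orP[GQ|//]] := lkP _ fs lG.
  have rGQ := rk_mono M GQ.
  by have /eqP[] := lk_rk_neq fs lG Qs; apply/eqP; rewrite eqn_leq rGQ andbT rQ.
by rewrite (fE p G) ?(subset_trans pQ) // (fE p' G) ?(subset_trans p'Q).
Qed.

End Flags.

(** * Flags of flats as a balanced fan; its nef and ample functions *)

Section BergmanFan.
Variables (R : realFieldType) (E : finType) (M : matroid E).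
Implicit Types (S F G H P Q : {set E}) (x y a b : E) (s t : {set {set E}}).

Notation d := (flag_dim M).
Notation flag := (flag M).
Notation lk := (link flag).
Notation gap := (gap M).

(** Linear functions on the quotient of the space of functions on [E] by the constants, evaluated at
    indicators of flats. The zero sum makes the value at [setT] vanish, as it does at [set0]. *)
Definition modular (l : {ffun {set E} -> R}) :=
  exists2 c : E -> R, \sum_x c x = 0 & forall F, l F = \sum_(x in F) c x.

Lemma modular0 : modular 0.
Proof. by exists (fun=> 0) => [|F]; rewrite ?ffunE big1. Qed.

Lemma modularD r u v : modular u -> modular v -> modular (r *! u + v).
Proof.
move=> [c c0 cE] [e e0 eE]; exists (fun x => r * c x + e x) => [|F].
  by rewrite big_split /= -mulr_sumr c0 e0 mulr0 addr0.
by rewrite !ffunE cE eE big_split /= mulr_sumr.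
Qed.

Definition separator a b : {ffun {set E} -> R} := [ffun H : {set E} => (a \in H)%:R - (b \in H)%:R].

Lemma sum_delta F a : \sum_(x in F) ((x == a)%:R : R) = (a \in F)%:R.
Proof.
case: (boolP (a \in F)) => aF.
  by rewrite (bigD1 a) //= eqxx big1 ?addr0 // => x /andP[_ /negPf->].
by rewrite big1 // => x xF; case: eqP => // e; rewrite -e xF in aF.
Qed.

Lemma modular_separator a b : modular (separator a b).
Proof.
exists (fun x => (x == a)%:R - (x == b)%:R) => [|F].
  rewrite sumrB -!(big_mkcond (fun _ => true)) /=.
  rewrite (eq_bigl (mem [set: E])) => [|x]; last by rewrite /= inE.
  rewrite [X in _ - X](eq_bigl (mem [set: E])) => [|x]; last by rewrite /= inE.
  by rewrite !sum_delta !inE subrr.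
by rewrite ffunE sumrB !sum_delta.
Qed.

(** The defaults 0 are never reached for [G] in a flag [s], by [flag_dual_spec]; they only make the
    function total. *)
Definition flag_dual s G : {ffun {set E} -> R} :=
  if [pick a in G | [forall H in s, (a \in H) ==> (G \subset H)]] is Some a then
    if [pick b in ~: G | [forall H in s, (G \proper H) ==> (b \in H)]] is Some b then
      separator a b else 0 else 0.

Lemma flag_dual_spec s G : flag s -> G \in s -> exists a b,
  [/\ flag_dual s G = separator a b,
      a \in G, {in s, forall H, a \in H -> G \subset H},
      b \notin G & {in s, forall H, G \proper H -> b \in H}].
Proof.
move=> fs Gs; rewrite /flag_dual; case: pickP => [a /andP[aG /forall_inP ha]|no]; last first.
  have [a aG ha] := flag_inner_point fs Gs; have := no a; rewrite aG /=.
  by case/negP; apply/forall_inP => H Hs; apply/implyP/ha.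
case: pickP => [b /andP[bG /forall_inP hb]|no]; last first.
  have [b bG hb] := flag_outer_point fs Gs; have := no b; rewrite inE bG /=.
  by case/negP; apply/forall_inP => H Hs; apply/implyP/hb.
exists a, b; split=> //.
- by move=> H Hs; apply/implyP/ha.
- by rewrite inE in bG.
- by move=> H Hs; apply/implyP/hb.
Qed.

Lemma modular_flag_dual s G : flag s -> G \in s -> modular (flag_dual s G).
Proof. by move=> fs Gs; have [a [b [-> _ _ _ _]]] := flag_dual_spec fs Gs; apply: modular_separator. Qed.

Lemma flag_dualE s F G : flag s -> F \in s -> G \in s -> flag_dual s F G = (G == F)%:R.
Proof.
move=> fs Fs Gs; have [a [b [-> aF ha bF hb]]] := flag_dual_spec fs Fs.
rewrite ffunE; have [->|nGF] := eqVneq G F; first by rewrite aF (negPf bF) subr0.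
case/orP: (flag_comparable fs Fs Gs) => FG.
  have FpG : F \proper G by rewrite properEneq eq_sym nGF.
  by rewrite (subsetP FG _ aF) hb // subrr.
have -> : a \in G = false.
  by apply/negP => /(ha G Gs) FG'; case/eqP: nGF; apply/eqP; rewrite eqEsubset FG.
by rewrite (contraNF (subsetP FG b) bF) subrr.
Qed.

Lemma sum_setD (c : E -> R) F P : P \subset F ->
  \sum_(x in F :\: P) c x = \sum_(x in F) c x - \sum_(x in P) c x.
Proof. by move=> PF; rewrite [in RHS](big_setID P) (setIidPr PF) /= addrAC subrr add0r. Qed.

(** Exactly one rank is missing, so the link consists of the flats strictly between some [P] and [Q]
    whose ranks differ by 2. By the unique cover axiom they partition [Q :\: P], and the sum of [l]
    over them is [l Q - l P], which is 0. *)
Lemma flag_balanced s l : flag s -> #|s|.+1 = d -> modular l ->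
  {in s, forall F, l F = 0} -> \sum_(F | lk s F) l F = 0.
Proof.
move=> fs sd [c c0 lE] l0.
have [j mj] : exists j : 'I_d.+1, missing_ranks M s = [set j].
  by apply/cards1P/eqP; apply: (@addnI #|s|); rewrite flag_card_missing // addn1.
have mE i : missing M s i -> i = j.
  move=> mi; have /andP[/andP[_ id] _] := mi.
  have : inord i \in missing_ranks M s by rewrite inE inordK.
  by rewrite mj inE => /eqP <-; rewrite inordK.
have [|P [Q [g /andP[Pj jQ]]]] := @missing_gap _ _ s j fs.
  by have := set11 j; rewrite -mj inE.
have [fP fQ PQ [P0 QT] h] := g.
have {}Pj : nat_of_ord j = (rk M P).+1.
  by apply/esym/mE/(gap_missing fs g); rewrite ltnSn (leq_ltn_trans Pj).
have {}jQ : rk M Q = j.+1.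
  apply/eqP; rewrite eqn_leq jQ andbT leqNgt; apply/negP => r.
  have /mE/eqP : missing M s j.+1 by apply: (gap_missing fs g); rewrite r Pj leqnSn.
  by rewrite eqn_leq ltnn.
have lP : \sum_(x in P) c x = 0.
  by rewrite -lE; case/orP: P0 => [/eqP->|/l0//]; rewrite lE big_set0.
have lQ : \sum_(x in Q) c x = 0.
  rewrite -lE; case/orP: QT => [/eqP->|/l0//]; rewrite lE -[RHS]c0.
  by apply: eq_bigl => x; rewrite inE.
have rkF F : lk s F -> rk M F = j by move=> lF; apply/mE/lk_missing.
have PF F : lk s F -> P \proper F.
  by move=> lF; apply: (lk_gap_lower fs g) => //; rewrite (rkF F lF) Pj.
have FQ F : lk s F -> F \proper Q.
  by move=> lF; apply: (lk_gap_upper fs g) => //; rewrite (rkF F lF) jQ.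
rewrite (eq_bigr (fun F => \sum_(x in F :\: P) c x)) => [|F lF]; last first.
  by rewrite lE sum_setD ?lP ?subr0 // proper_sub ?PF.
rewrite (exchange_big_dep (mem (Q :\: P))) /=; last first.
  move=> F x /FQ /proper_sub/subsetP FQ'; rewrite !inE => /andP[-> /FQ'] //.
transitivity (\sum_(x in Q) c x - \sum_(x in P) c x); last by rewrite lQ lP subr0.
rewrite -sum_setD ?proper_sub //.
apply: eq_bigr => x; rewrite inE => /andP[xP xQ].
rewrite (big_pred1 (cl M (x |: P))) // => F; rewrite !inE xP /=.
apply/andP/eqP => [[lF xF]|->].
  apply: flat_eq_cl => //; first exact: lk_flat lF.
    by rewrite proper_sub ?PF.
  by rewrite rkF ?Pj.
split; last exact: mem_cl_setU1.
by apply: (gap_atom_lk fs g) => //; rewrite jQ Pj.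
Qed.

Definition bergman_fan : fan R {set E} :=
  @Fan R {set E} d flag modular flag_dual (@flag_sub E M) modular0 modularD
    modular_flag_dual flag_dualE flag_balanced.

Notation ample := (ample bergman_fan).
Notation nef := (nef bergman_fan).
Notation deg := (deg bergman_fan).

Definition pencil_in a : {ffun {set E} -> R} := [ffun F : {set E} => (a \in F)%:R].
Definition pencil_out a : {ffun {set E} -> R} := [ffun F : {set E} => (a \notin F)%:R].

(** Modulo linear functions the choice of element does not matter. Each flag may use its own: a
    point outside all its flats for [pencil_in], a point in all of them for [pencil_out]. *)
Lemma pencil_in_modular a b : modular (pencil_in a - pencil_in b).
Proof.
have -> : pencil_in a - pencil_in b = separator a b by apply/ffunP => F; rewrite !ffunE.
exact: modular_separator.
Qed.

Lemma pencil_out_modular a b : modular (pencil_out a - pencil_out b).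
Proof.
have -> : pencil_out a - pencil_out b = separator b a.
  by apply/ffunP => F; rewrite !ffunE; do 2!case: (_ \in F); rewrite /= ?subrr.
exact: modular_separator.
Qed.

Lemma flag_common_outside s (a0 : E) : flag s -> exists x, forall F, F \in s -> x \notin F.
Proof.
move=> fs; have [->|/set0Pn[G Gs]] := eqVneq s set0; first by exists a0 => F; rewrite inE.
case: (arg_maxnP (fun H : {set E} => #|H|) Gs) => T Ts Tmax.
have /flagP[/(_ T Ts) /and3P[_ _ TT] _] := fs.
have /properP[_ [x _ xT]] : T \proper setT by rewrite properT.
exists x => F Fs; apply: contra xT; apply/subsetP.
case/orP: (flag_comparable fs Fs Ts) => // TF.
by have /eqP -> : T == F by rewrite eqEcard TF; apply: Tmax.
Qed.

Lemma flag_common_inside s (a0 : E) : flag s -> exists x, forall F, F \in s -> x \in F.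
Proof.
move=> fs; have [->|/set0Pn[G Gs]] := eqVneq s set0; first by exists a0 => F; rewrite inE.
case: (arg_minnP (fun H : {set E} => #|H|) Gs) => T Ts Tmin.
have /flagP[/(_ T Ts) /and3P[_ T0 _] _] := fs.
have /set0Pn[x xT] := T0.
exists x => F Fs; apply: (subsetP _ _ xT).
case/orP: (flag_comparable fs Ts Fs) => // FT.
by have /eqP -> : F == T by rewrite eqEcard FT; apply: Tmin.
Qed.

Lemma pencil_in_nef a : nef (pencil_in a).
Proof.
move=> s fs _; have [x hx] := flag_common_outside a fs.
exists (pencil_in x); split; first exact: pencil_in_modular.
  by move=> F Fs; rewrite ffunE (negPf (hx F Fs)).
by move=> F _; rewrite ffunE ler0n.
Qed.

Lemma pencil_out_nef a : nef (pencil_out a).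
Proof.
move=> s fs _; have [x hx] := flag_common_inside a fs.
exists (pencil_out x); split; first exact: pencil_out_modular.
  by move=> F Fs; rewrite ffunE (hx F Fs).
by move=> F _; rewrite ffunE ler0n.
Qed.

(** This is the strictly submodular function [#|F| * #|~: F|], kept as a sum over ordered pairs so
    that it can be corrected pair by pair. *)
Definition crossing_pairs : {ffun {set E} -> R} :=
  [ffun F : {set E} => \sum_a \sum_b (a \in F)%:R * (b \notin F)%:R].

(* The correction exchanges the two elements of each pair separated in the
   wrong order by [s], so that only pairs with [a] not below [b] in the flag
   are counted. *)
Lemma crossing_pairs_ample : ample crossing_pairs.
Proof.
move=> s fs _.
pose sep a b := [exists H in s, (a \in H) && (b \notin H)].
pose l : {ffun {set E} -> R} :=
  \sum_a \sum_b (if sep a b then separator b a else 0).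
have ml : modular l.
  apply: (@glin_sum R _ bergman_fan) => a _; apply: (@glin_sum R _ bergman_fan) => b _.
  by case: ifP => _; [apply: modular_separator | apply: modular0].
pose term F a b : R := (a \in F)%:R * (b \notin F)%:R +
  (if sep a b then (b \in F)%:R - (a \in F)%:R else 0).
have uE F : (crossing_pairs + l) F = \sum_a \sum_b term F a b.
  rewrite !ffunE sum_ffunE -big_split /=; apply: eq_bigr => a _.
  rewrite sum_ffunE -big_split /=; apply: eq_bigr => b _.
  by rewrite /term; case: ifP; rewrite ffunE.
have termE F a b : term F a b =
    if sep a b then (b \in F)%:R * (a \notin F)%:R else (a \in F)%:R * (b \notin F)%:R.
  rewrite /term; case: ifP => _; last by rewrite addr0.
  by case: (a \in F); case: (b \in F); rewrite /= ?mulr1 ?mulr0 ?subrr ?addr0 ?add0r ?subr0 ?addrN.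
have term_ge0 F a b : 0 <= term F a b.
  by rewrite termE; case: ifP => _; rewrite mulr_ge0 ?ler0n.
exists (crossing_pairs + l); split.
- by rewrite opprD addrA subrr add0r; apply: (@glinN R _ bergman_fan).
- move=> F Fs; rewrite uE big1 // => a _; rewrite big1 // => b _; rewrite termE.
  case: ifPn => [/exists_inP[H Hs /andP[aH bH]]|/exists_inP ns].
    have [bF|] := boolP (b \in F); last by rewrite mul0r.
    have [aF|aF] := boolP (a \in F); first by rewrite mulr0.
    case/orP: (flag_comparable fs Hs Fs) => /subsetP sub.
      by rewrite sub in aF.
    by rewrite sub in bH.
  have [aF|] := boolP (a \in F); last by rewrite mul0r.
  have [bF|bF] := boolP (b \in F); first by rewrite mulr0.
  by case: ns; exists F => //; rewrite aF.
- move=> F lF; rewrite uE.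
  have fF : flag (F |: s) by case/andP: lF.
  (* The pair formed by an inner and an outer point of [F] is separated by no [H] in [s]: if [a] is
     in [H], then [F] is properly contained in [H], which therefore contains [b]. *)
  have [a aF ha] := flag_inner_point fF (setU11 F s).
  have [b bF hb] := flag_outer_point fF (setU11 F s).
  have pos : 0 < term F a b.
    rewrite termE ifN ?aF ?bF ?mulr1 ?ltr01 //.
    apply/exists_inP => -[H Hs /andP[aH bH]]; case/negP: bH.
    have Hs' : H \in F |: s by rewrite inE Hs orbT.
    apply: hb => //; rewrite properEneq ha // andbT.
    by apply/eqP => e; case/andP: lF; rewrite e Hs.
  rewrite (bigD1 a) //= (bigD1 b) //=; apply: ltr_pwDl.
    by apply: ltr_pwDl => //; apply: sumr_ge0.
  by apply: sumr_ge0 => c _; apply: sumr_ge0.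
Qed.

End BergmanFan.

(** * The intersection form of a two-dimensional link *)

Section SurfaceForm.
Variables (R : realFieldType) (E : finType) (M : matroid E) (s : {set {set E}}).
Implicit Types (F G H P Q p l : {set E}) (x y : E).

Notation d := (flag_dim M).
Notation flag := (flag M).
Notation lk := (link flag).
Notation gap := (gap M).
Notation fan := (bergman_fan R M).
Notation deg := (deg fan).

Hypothesis fs : flag s.
Hypothesis sd : (#|s| + 2)%N = d.

Variables j k : nat.
Hypothesis jk : (j < k)%N.
Hypothesis missE : forall i, missing M s i = (i == j) || (i == k).

Definition low F := lk s F && (rk M F == j).
Definition high F := lk s F && (rk M F == k).

Lemma lk_low_high F : lk s F = low F || high F.
Proof.
rewrite /low /high; case: (boolP (lk s F)) => //= lF.
by have := lk_missing fs lF; rewrite missE.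
Qed.

Lemma lowNhigh F : low F -> high F = false.
Proof. by case/andP=> _ /eqP e; rewrite /high e ltn_eqF ?andbF. Qed.

Lemma low_lk F : low F -> lk s F. Proof. by case/andP. Qed.
Lemma high_lk F : high F -> lk s F. Proof. by case/andP. Qed.
Lemma low_rk F : low F -> rk M F = j. Proof. by case/andP=> _ /eqP. Qed.
Lemma high_rk F : high F -> rk M F = k. Proof. by case/andP=> _ /eqP. Qed.

Lemma lk_setU1_low p l : low p -> lk (p |: s) l = high l && (p \subset l).
Proof.
move=> hp; have lp := low_lk hp.
apply/idP/andP => [lpl|[hl pl]]; last first.
  rewrite (lk_pair fs lp (high_lk hl)) ?pl //.
  by apply: contraTneq hl => <-; rewrite lowNhigh.
have [ll _] : lk s l /\ lk (l |: s) p.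
  by have := lk_sym_of (@flag_sub _ M) s p l; rewrite lp lpl => /esym/andP[].
have fp : flag (p |: s) by case/andP: lp.
have npl : rk M p != rk M l by apply: (lk_rk_neq fp lpl); apply: setU11.
have hl : high l.
  have := lk_missing fs ll; rewrite missE /high ll => /orP[/eqP e|//].
  by rewrite low_rk // e eqxx in npl.
split=> //; have npl' : p != l by apply: contraNneq npl => ->.
move: lpl; rewrite lk_pair // => /orP[//|/(rk_mono M)].
by rewrite (low_rk hp) (high_rk hl) leqNgt jk.
Qed.

Lemma lk_setU1_high p l : high l -> lk (l |: s) p = low p && (p \subset l).
Proof.
move=> hl; have ll := high_lk hl.
apply/idP/andP => [llp|[hp pl]]; last first.
  rewrite (lk_pair fs ll (low_lk hp)) ?pl ?orbT //.
  by apply: contraTneq hl => ->; rewrite lowNhigh.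
have [lp lpl] : lk s p /\ lk (p |: s) l.
  by have := lk_sym_of (@flag_sub _ M) s l p; rewrite ll llp => /esym/andP[].
have fl : flag (l |: s) by case/andP: ll.
have npl : rk M l != rk M p by apply: (lk_rk_neq fl llp); apply: setU11.
have hp : low p.
  have := lk_missing fs lp; rewrite missE /low lp => /orP[//|/eqP e].
  by rewrite high_rk // e eqxx in npl.
by have := lk_setU1_low l hp; rewrite lpl => /esym/andP[].
Qed.

Lemma sum_lk (f : {set E} -> R) :
  \sum_(F | lk s F) f F = \sum_(F | low F) f F + \sum_(F | high F) f F.
Proof.
rewrite (bigID low) /=; congr (_ + _); apply: eq_bigl => F; rewrite lk_low_high.
  by case: (boolP (low F)); rewrite ?andbT ?andbF.
by case: (boolP (low F)) => [/lowNhigh->|]; rewrite ?andbF ?andbT.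
Qed.

(** Minus the self-intersection of the ray [p], computed by moving the ray off itself with its dual
    function. *)
Definition low_self p : R := \sum_(l | high l && (p \subset l)) flag_dual R (p |: s) p l.
Definition high_self l : R := \sum_(p | low p && (p \subset l)) flag_dual R (l |: s) l p.

Lemma surface_form (u v : {ffun {set E} -> R}) :
  {in s, forall F, u F = 0} -> {in s, forall F, v F = 0} ->
  deg [:: u; v] s =
    \sum_(p | low p) \sum_(l | high l && (p \subset l)) (u p * v l + u l * v p)
  - (\sum_(p | low p) u p * v p * low_self p + \sum_(l | high l) u l * v l * high_self l).
Proof.
move=> u0 v0; rewrite deg_cons2 // !(@reduce_id _ _ fan s) // !sum_lk.
congr (_ - (_ + _)).
- transitivity (\sum_(p | low p) \sum_(l | high l && (p \subset l)) u p * v l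
    + \sum_(p | low p) \sum_(l | high l && (p \subset l)) u l * v p); last first.
    by rewrite -big_split; apply: eq_bigr => p _; rewrite -big_split.
  congr (_ + _).
    apply: eq_bigr => p hp; apply: eq_big => [l|l _]; last by rewrite mulr1.
    exact: lk_setU1_low.
  rewrite [RHS](exchange_big_dep high) => [|p l _ /andP[]//].
  apply: eq_bigr => l hl; apply: eq_big => [p|p _]; last by rewrite mulr1.
  by rewrite lk_setU1_high // hl.
- apply: eq_bigr => p hp; congr (_ * _); apply: eq_big => [l|l _]; last by rewrite mulr1.
  exact: lk_setU1_low.
- apply: eq_bigr => l hl; congr (_ * _); apply: eq_big => [p|p _]; last by rewrite mulr1.
  exact: lk_setU1_high.
Qed.

Lemma exists_low : exists p, low p.
Proof.
have sd1 : (#|s| < d)%N by rewrite -sd addn2 ltnS leqnSn.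
have [F lF] := flag_link_nonempty fs sd1.
have := lF; rewrite lk_low_high => /orP[hF|hF]; first by exists F.
have fF : flag (F |: s) by case/andP: lF.
have sdF : (#|F |: s| < d)%N by rewrite (lk_card lF) -sd addn2.
have [p] := flag_link_nonempty fF sdF.
by rewrite lk_setU1_high // => /andP[hp _]; exists p.
Qed.

Section TwoGaps.
Variable Q : {set E}.
Hypothesis Qs : Q \in s.
Hypothesis low_sub : forall p, low p -> p \proper Q.
Hypothesis high_sub : forall l, high l -> Q \proper l.

Lemma low_sub_high p l : low p -> high l -> p \subset l.
Proof. by move=> /low_sub/proper_sub pQ /high_sub/proper_sub; apply: subset_trans. Qed.

Lemma two_gaps_low_self p : low p -> low_self p = 0.
Proof.
move=> hp; have fp : flag (p |: s) by case/andP: (low_lk hp).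
have [a [b [e ap ha bp hb]]] := flag_dual_spec R fp (setU11 p s).
rewrite /low_self e big1 // => l /andP[hl pl]; rewrite ffunE (subsetP pl) //.
have bQ : b \in Q by apply: hb; rewrite ?low_sub // inE Qs orbT.
by rewrite (subsetP (proper_sub (high_sub hl))) // subrr.
Qed.

Lemma two_gaps_high_self l : high l -> high_self l = 0.
Proof.
move=> hl; have fl : flag (l |: s) by case/andP: (high_lk hl).
have [a [b [e al ha bl hb]]] := flag_dual_spec R fl (setU11 l s).
rewrite /high_self e big1 // => p /andP[hp pl]; rewrite ffunE.
have bp : b \notin p by apply: contra bl; apply/subsetP.
have ap : a \notin p.
  apply: contraT; rewrite negbK => ap.
  have lQ : l \subset Q.
    by apply: ha; rewrite ?inE ?Qs ?orbT // (subsetP (proper_sub (low_sub hp))).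
  by have := sub_proper_trans lQ (high_sub hl); rewrite properxx.
by rewrite (negPf ap) (negPf bp) subrr.
Qed.

(** Every low flat is contained in every high one and all self-intersections vanish, so the form
    depends only on the two sums and is a hyperbolic plane. *)
Lemma two_gaps_form (u v : {ffun {set E} -> R}) :
  {in s, forall F, u F = 0} -> {in s, forall F, v F = 0} ->
  deg [:: u; v] s =
    (\sum_(p | low p) u p) * (\sum_(l | high l) v l) +
    (\sum_(p | low p) v p) * (\sum_(l | high l) u l).
Proof.
move=> u0 v0; rewrite surface_form //.
rewrite [X in _ - (X + _)]big1 => [|p hp]; last by rewrite two_gaps_low_self ?mulr0.
rewrite [X in _ - (_ + X)]big1 => [|l hl]; last by rewrite two_gaps_high_self ?mulr0.
rewrite addr0 subr0 !mulr_suml -big_split; apply: eq_bigr => p hp /=.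
rewrite !mulr_sumr -big_split /=; apply: eq_big => [l|l _]; last by rewrite [u l * _]mulrC.
by case: (boolP (high l)) => // hl; rewrite low_sub_high.
Qed.

End TwoGaps.

Section OneGap.
Variables P Q : {set E}.
Hypothesis gPQ : gap s P Q.
Hypothesis rkP : j = (rk M P).+1.
Hypothesis rkQ : rk M Q = k.+1.
Hypothesis kj : k = j.+1.

Let fP : P \in flats M. Proof. by case: gPQ. Qed.
Let fQ : Q \in flats M. Proof. by case: gPQ. Qed.

Lemma low_between p : low p -> [/\ p \in flats M, P \proper p & p \proper Q].
Proof.
move=> hp; split; first exact: lk_flat fs (low_lk hp).
  by apply: (lk_gap_lower fs gPQ) (low_lk hp) _; rewrite (low_rk hp) rkP.
by apply: (lk_gap_upper fs gPQ) (low_lk hp) _; rewrite (low_rk hp) rkQ ltnS ltnW.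
Qed.

Lemma high_between l : high l -> [/\ l \in flats M, P \proper l & l \proper Q].
Proof.
move=> hl; split; first exact: lk_flat fs (high_lk hl).
  by apply: (lk_gap_lower fs gPQ) (high_lk hl) _; rewrite (high_rk hl) kj rkP ltnS leqnSn.
by apply: (lk_gap_upper fs gPQ) (high_lk hl) _; rewrite (high_rk hl) rkQ.
Qed.

(** In an interval of rank 3, low flats are points and high flats are lines: this is the point of
    [l] through [x], and [high_through] is the line joining [p] to [x]. *)
Lemma low_through l x : high l -> x \in l -> x \notin P ->
  (fun p => (low p && (p \subset l)) && (x \in p)) =1 pred1 (cl M (x |: P)).
Proof.
move=> hl xl xP p /=; have [fl Pl lQ] := high_between hl.
apply/andP/eqP => [[/andP[hp pl] xp]|->].
  have [fp Pp pQ] := low_between hp.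
  by apply: flat_eq_cl; rewrite ?proper_sub // (low_rk hp) rkP.
split; last exact: mem_cl_setU1.
rewrite cl_setU1_sub ?proper_sub // andbT /low rk_cl_setU1 // rkP eqxx andbT.
apply: (gap_atom_lk fs gPQ) => //; first by rewrite (subsetP (proper_sub lQ)).
by rewrite rkQ kj rkP ltnS leqnSn.
Qed.

Lemma high_through p x : low p -> x \in Q -> x \notin p ->
  (fun l => (high l && (p \subset l)) && (x \in l)) =1 pred1 (cl M (x |: p)).
Proof.
move=> hp xQ xp l /=; have [fp Pp pQ] := low_between hp.
apply/andP/eqP => [[/andP[hl pl] xl]|->].
  have [fl Pl lQ] := high_between hl.
  by apply: flat_eq_cl; rewrite // (high_rk hl) kj (low_rk hp).
split; last exact: mem_cl_setU1.
have r : rk M (cl M (x |: p)) = k by rewrite rk_cl_setU1 // (low_rk hp) kj.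
rewrite sub_cl_setU1 andbT /high r eqxx andbT.
apply: (gap_lk fs gPQ); first exact: cl_flat.
  by apply: proper_sub_trans Pp _; apply: sub_cl_setU1.
rewrite properEneq cl_setU1_sub ?proper_sub // andbT.
by apply/eqP => e; move: r; rewrite e rkQ => /eqP; rewrite gtn_eqF.
Qed.

Lemma sum_indicator (A B : pred {set E}) :
  \sum_(F | A F) ((B F)%:R : R) = \sum_(F | A F && B F) 1.
Proof. by rewrite big_mkcondr; apply: eq_bigr => F _; case: (B F). Qed.

Definition high_count p : R := \sum_(l | high l && (p \subset l)) 1.

(** The outer point [b] of the dual function lies in [Q] outside [p], and exactly one of the lines
    through [p] contains it. Dually, [one_gap_high_self] counts the only point of [l] containing the
    inner point. *)
Lemma one_gap_low_self p : low p -> low_self p = high_count p - 1.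
Proof.
move=> hp; have fp : flag (p |: s) by case/andP: (low_lk hp).
have [a [b [e ap ha bp hb]]] := flag_dual_spec R fp (setU11 p s).
have [_ Pp pQ] := low_between hp.
have bQ : b \in Q.
  case: gPQ => _ _ _ [_ /orP[/eqP->|Qs]] _; first by rewrite inE.
  by apply: hb => //; rewrite inE Qs orbT.
transitivity (\sum_(l | high l && (p \subset l)) (1 - (b \in l)%:R : R)).
  by rewrite /low_self e; apply: eq_bigr => l /andP[_ pl]; rewrite ffunE (subsetP pl).
rewrite sumrB; congr (_ - _).
by rewrite sum_indicator (big_pred1 _ (high_through hp bQ bp)).
Qed.

Lemma one_gap_high_self l : high l -> high_self l = 1.
Proof.
move=> hl; have fl : flag (l |: s) by case/andP: (high_lk hl).
have [a [b [e al ha bl hb]]] := flag_dual_spec R fl (setU11 l s).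
have [_ Pl lQ] := high_between hl.
have aP : a \notin P.
  case: gPQ => _ _ _ [/orP[/eqP->|Ps] _] _; first by rewrite inE.
  apply: contraT; rewrite negbK => /ha lP.
  by have := proper_sub_trans Pl (lP _); rewrite properxx inE Ps orbT => /(_ isT).
transitivity (\sum_(p | low p && (p \subset l)) ((a \in p)%:R : R)).
  rewrite /high_self e; apply: eq_bigr => p /andP[_ pl].
  by rewrite ffunE (contraNF (subsetP pl b) bl) subr0.
by rewrite sum_indicator (big_pred1 _ (low_through hl al aP)).
Qed.

Lemma high_through2 p p' : low p -> low p' -> p != p' ->
  \sum_(l | high l && (p \subset l) && (p' \subset l)) 1 = 1 :> R.
Proof.
move=> hp hp' npp'; have [fp Pp pQ] := low_between hp.
have [fp' Pp' p'Q] := low_between hp'.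
have [x xp' xp] : exists2 x, x \in p' & x \notin p.
  apply/subsetPn; apply: contra npp' => p'p.
  by rewrite (flat_eq_rk fp' p'p) // (low_rk hp) (low_rk hp').
have xP : x \notin P by apply: contra xp; apply/subsetP/proper_sub.
have e : p' = cl M (x |: P).
  by apply: flat_eq_cl; rewrite ?proper_sub // (low_rk hp') rkP.
rewrite (eq_bigl (fun l => high l && (p \subset l) && (x \in l))) => [|l].
  by rewrite (big_pred1 _ (high_through hp (subsetP (proper_sub p'Q) x xp') xp)).
case: (boolP (high l)) => //= hl; have [fl Pl _] := high_between hl.
by rewrite e sub_cl_flat // subUset sub1set (proper_sub Pl) andbT.
Qed.

(* Modulo modular functions, [x = (\sum_p x p) alpha + \sum_l (transverse x l) l], where [alpha] has square
   1 and is orthogonal to the rays [l], which are orthonormal up to sign. *)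
Definition transverse (u : {ffun {set E} -> R}) l : R :=
  u l - \sum_(p | low p && (p \subset l)) u p.

Lemma one_gap_form (u v : {ffun {set E} -> R}) :
  {in s, forall F, u F = 0} -> {in s, forall F, v F = 0} ->
  deg [:: u; v] s = (\sum_(p | low p) u p) * (\sum_(p | low p) v p)
    - \sum_(l | high l) transverse u l * transverse v l.
Proof.
move=> u0 v0; rewrite surface_form //.
have -> : \sum_(p | low p) \sum_(l | high l && (p \subset l)) (u p * v l + u l * v p) =
    \sum_(l | high l) \sum_(p | low p && (p \subset l)) (u p * v l + u l * v p).
  rewrite (exchange_big_dep high) => [|p l _ /andP[]//] /=.
  by apply: eq_bigr => l hl; apply: eq_bigl => p; rewrite hl.
have -> : \sum_(l | high l) u l * v l * high_self l = \sum_(l | high l) u l * v l.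
  by apply: eq_bigr => l hl; rewrite one_gap_high_self // mulr1.
(* Two distinct points lie on one common line, so each pair is counted once; a point paired with
   itself is counted [high_count p] times, which is [low_self p + 1]. *)
have cross : \sum_(l | high l) (\sum_(p | low p && (p \subset l)) u p) *
      (\sum_(p | low p && (p \subset l)) v p) =
    (\sum_(p | low p) u p) * (\sum_(p | low p) v p)
    + \sum_(p | low p) u p * v p * low_self p.
  transitivity (\sum_(p | low p) \sum_(p' | low p')
      u p * v p' * \sum_(l | high l && (p \subset l) && (p' \subset l)) 1).
    under eq_bigr => l _ do rewrite mulr_suml.
    rewrite (exchange_big_dep low) => [|l p _ /andP[]//] /=.
    apply: eq_bigr => p hp.
    under eq_bigr => l _ do rewrite mulr_sumr.
    rewrite (exchange_big_dep low) => [|l p' _ /andP[]//] /=.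
    apply: eq_bigr => p' hp'; rewrite mulr_sumr; apply: eq_big => [l|l _]; last by rewrite mulr1.
    by rewrite hp hp'.
  rewrite mulr_suml -big_split; apply: eq_bigr => p hp /=.
  rewrite mulr_sumr (bigD1 p) //= [in RHS](bigD1 p) //= addrAC; congr (_ + _).
    rewrite one_gap_low_self // -[X in X + _]mulr1 -mulrDr subrKC.
    by congr (_ * _); apply: eq_bigl => l; rewrite -andbA andbb.
  by apply: eq_bigr => p' /andP[hp' npp']; rewrite high_through2 ?mulr1 // eq_sym.
have -> : \sum_(l | high l) transverse u l * transverse v l =
    \sum_(l | high l) u l * v l
    - \sum_(l | high l) \sum_(p | low p && (p \subset l)) (u p * v l + u l * v p)
    + \sum_(l | high l) (\sum_(p | low p && (p \subset l)) u p) *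
      (\sum_(p | low p && (p \subset l)) v p).
  rewrite -sumrB -big_split; apply: eq_bigr => l _ /=.
  rewrite big_split /= -mulr_suml -mulr_sumr /transverse; ring.
rewrite cross; ring.
Qed.

End OneGap.
End SurfaceForm.

Section SurfaceNegative.
Variables (R : realFieldType) (E : finType) (M : matroid E).

Notation d := (flag_dim M).
Notation fan := (bergman_fan R M).

(** A vector [(X, y)] orthogonal, for the Lorentzian form, to the positive vector [(W, z)] is not
    positive. The proof of Cauchy-Schwarz by a sum of squares is inlined. *)
Lemma square_bound (I : finType) (P : pred I) (y z : I -> R) (X W : R) :
  0 < W -> \sum_(i | P i) z i ^+ 2 < W ^+ 2 -> X * W = \sum_(i | P i) y i * z i ->
  X ^+ 2 <= \sum_(i | P i) y i ^+ 2.
Proof.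
move=> W0 zW XW.
have : 0 <= \sum_(i | P i) (W * y i - X * z i) ^+ 2 by apply: sumr_ge0 => i _; apply: sqr_ge0.
have -> : \sum_(i | P i) (W * y i - X * z i) ^+ 2 =
   W ^+ 2 * \sum_(i | P i) y i ^+ 2 - 2 * (X * W) * \sum_(i | P i) y i * z i
   + X ^+ 2 * \sum_(i | P i) z i ^+ 2.
  rewrite !mulr_sumr -sumrB -big_split; apply: eq_bigr => i _ /=; ring.
rewrite -XW => h.
have h2 : X ^+ 2 * \sum_(i | P i) z i ^+ 2 <= X ^+ 2 * W ^+ 2.
  by rewrite ler_wpM2l ?sqr_ge0 // ltW.
have W2 : 0 < W ^+ 2 by rewrite exprn_gt0.
rewrite -(ler_pM2l W2); move: h h2.
have -> : 2 * (X * W) * (X * W) = 2 * (W ^+ 2 * X ^+ 2) by ring.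
by rewrite [X ^+ 2 * W ^+ 2]mulrC; lra.
Qed.

Theorem flag_surface_negative s w x : flag M s -> (#|s| + 2)%N = d -> ample fan w ->
  deg fan [:: x; w] s = 0 -> deg fan [:: x; x] s <= 0.
Proof.
move=> fs sd aw.
have sd1 : (#|s| < d)%N by rewrite -sd addn2 ltnS leqnSn.
have [u [wu u0 up]] := aw s fs sd1.
have x'0 := reduce0 (X := fan) x fs; have lx := reduce_linear (X := fan) x fs.
move: (reduce fan s x) x'0 lx => y y0 lxy.
have sdE : (#|s| + (size (@nil {ffun {set E} -> R})).+2)%N = fdim fan by [].
have sdw v t : (#|s| + (size [:: v : {ffun {set E} -> R}]).+1)%N = fdim fan by [].
have congr2 a a' b b' : modular (a - a') -> modular (b - b') ->
    deg fan [:: a; b] s = deg fan [:: a'; b'] s.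
  move=> la lb; rewrite (deg_congr (X := fan) (v := a')) // deg_swap //.
  by rewrite (deg_congr (X := fan) (v := b')) // deg_swap.
have uu : 0 < deg fan [:: u; u] s.
  rewrite -(congr2 w u w u) //; apply: deg_gt0 => //.
  - exact: flag_link_nonempty.
  - by move=> v; rewrite !inE => /orP[]/eqP->.
rewrite (congr2 x y w u) // (congr2 x y x y) //.
have [j [k [jk mE]]] : exists j k, (j < k)%N /\ forall i, missing M s i = (i == j) || (i == k).
  have /cards2P[i1 [i2 [ni mr]]] : #|missing_ranks M s| == 2%N.
    by apply/eqP/(@addnI #|s|); rewrite flag_card_missing.
  have mE i : missing M s i = (i == i1) || (i == i2).
    case: (leqP i d) => [id|di].
      have : (inord i \in missing_ranks M s) = missing M s i by rewrite inE inordK.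
      by rewrite mr !inE -!(inj_eq val_inj) /= inordK // => ->.
    rewrite /missing [(i <= d)%N]leqNgt di andbF; apply/esym/negbTE; rewrite negb_or.
    by rewrite !gtn_eqF // (leq_ltn_trans _ di) // -ltnS.
  move: ni; rewrite -(inj_eq val_inj) neq_ltn => /orP[l|l]; first by exists i1, i2.
  by exists i2, i1; split=> // i; rewrite orbC.
have mj : missing M s j by rewrite mE eqxx.
have mk : missing M s k by rewrite mE eqxx orbT.
have [P [Q [g /andP[Pj jQ]]]] := missing_gap fs mj.
have nmP := gap_lower_not_missing g; have nmQ := gap_upper_not_missing g.
have gm i := gap_missing (i := i) fs g.
have rP : j = (rk M P).+1.
  apply/esym/eqP; have := gm (rk M P).+1; rewrite ltnSn (leq_ltn_trans Pj jQ) => /(_ isT).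
  rewrite mE => /orP[//|/eqP e]; move: Pj; rewrite e; lia.
have [p0 lp0] := exists_low fs sd jk mE.
have lowp F : low M s j F -> 0 < u F by move=> /andP[lF _]; apply: up.
have U0 : 0 < \sum_(p | low M s j p) u p.
  rewrite (bigD1 p0) //= ltr_pwDl ?lowp // sumr_ge0 // => F /andP[hF _].
  exact/ltW/lowp.
(* Either both missing ranks lie in one gap, an interval of rank 3, or [k] lies above [Q] and there
   are two gaps of rank 2. *)
have [kQ|Qk] := ltnP k (rk M Q).
  have kj : k = j.+1.
    apply/eqP; rewrite eqn_leq jk andbT leqNgt; apply/negP => r.
    have : missing M s j.+1 by apply: gm; lia.
    by rewrite mE => /orP[] /eqP; lia.
  have rQ : rk M Q = k.+1.
    apply/eqP; rewrite eqn_leq kQ andbT leqNgt; apply/negP => r.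
    have : missing M s k.+1 by apply: gm; lia.
    by rewrite mE => /orP[] /eqP; lia.
  have form := one_gap_form fs sd jk mE g rP rQ kj.
  rewrite !form // => /eqP; rewrite subr_eq0 => /eqP e.
  move: uu; rewrite form // subr_gt0 -expr2 => zW.
  rewrite subr_le0 -expr2.
  under [leRHS]eq_bigr do rewrite -expr2.
  apply: (square_bound U0 _ e); apply: le_lt_trans zW.
  by under eq_bigr do rewrite expr2.
have {}Qk : (rk M Q < k)%N.
  by rewrite ltn_neqAle Qk andbT; apply: contraNneq nmQ => ->.
have Qs : Q \in s.
  case: g => _ _ _ [_ /orP[/eqP e|//]] _.
  by case/andP: mk => /andP[_ kd] _; move: Qk; rewrite e -/(mrank M); move: kd; rewrite /flag_dim; lia.
have lowQ p : low M s j p -> p \proper Q.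
  by move=> /andP[lp /eqP rp]; apply: (lk_gap_upper fs g lp); rewrite rp.
have highQ l : high M s k l -> Q \proper l.
  move=> /andP[ll /eqP rl]; have [_ _ /(_ Q Qs) c] := lkP _ fs ll.
  case/orP: c => [/(rk_mono M)|Ql]; first by rewrite rl leqNgt Qk.
  by rewrite properEneq Ql andbT; apply: contraTneq Qk => ->; rewrite rl ltnn.
have form := two_gaps_form fs sd jk mE Qs lowQ highQ.
rewrite !form // => e.
have V0 : 0 <= \sum_(l | high M s k l) u l.
  by apply: sumr_ge0 => l /andP[ll _]; apply/ltW/up.
move: U0 V0 e; set U := \sum_(p | _) u p; set V := \sum_(l | _) u l.
set X := \sum_(p | _) y p; set Y := \sum_(l | _) y l => U0 V0 e.
suff : X * Y <= 0 by lra.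
rewrite -(pmulr_rle0 _ U0).
have -> : U * (X * Y) = - (X ^+ 2 * V) by rewrite mulrCA -[U * Y](addrK (X * V)) [U * Y + _]addrC e; ring.
by rewrite oppr_le0 mulr_ge0 ?sqr_ge0.
Qed.

End SurfaceNegative.

(** * Coefficients of the characteristic polynomial as intersection numbers *)

Section Mobius.
Variables (E : finType) (M : matroid E).
Implicit Types (S F G : {set E}) (x : E).

(* The Moebius function value mu(0, F) of the lattice of flats, as a cross-cut sum. *)
Definition mobius F : int := \sum_(S : {set E} | cl M S == F) (-1) ^+ #|S|.

Definition abs_mobius F : int := (-1) ^+ rk M F * mobius F.

Definition hyperplane_avoiding x F G :=
  [&& G \in flats M, G \subset F, x \notin G & rk M F == (rk M G).+1].

(** Weisner's theorem at [x]. A set of closure [F] containing [x] is paired with its deletion of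
    [x]; if the deletion still has closure [F], the two cancel. The other deletions are the sets
    whose closure [G] avoids [x] and satisfies [F = cl M (x |: G)]. *)
Lemma mobius_rec F x : F \in flats M -> x \in F ->
  mobius F = - \sum_(G | hyperplane_avoiding x F G) mobius G.
Proof.
move=> fF xF; rewrite /mobius (bigID (fun S : {set E} => x \in S)) /=.
rewrite (reindex_onto (fun S => x |: S) (fun S => S :\ x)) /=; last first.
  by move=> S /andP[_ xS]; rewrite setD1K.
rewrite (eq_bigl (fun S => (x \notin S) && (cl M (x |: S) == F))); last first.
  move=> S; rewrite setU11 andbT andbC; congr (_ && _).
  apply/eqP/idP => [<-|xS]; first by rewrite !inE eqxx.
  by rewrite setU1K.
rewrite (eq_bigr (fun S => - (-1) ^+ #|S|)) => [|S /andP[xS _]]; last first.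
  by rewrite cardsU1 xS /= exprS mulN1r.
rewrite sumrN (bigID (fun S => cl M S == F)) /= opprD -addrA addrCA.
rewrite [X in _ + (- X + _)](eq_bigl (fun S => (cl M S == F) && (x \notin S))); last first.
  move=> S; rewrite andbC; case: (boolP (cl M S == F)) => //= /eqP clS.
  rewrite andbC; case: (boolP (x \in S)) => /= _; rewrite ?andbF // andbT; apply/eqP.
  by rewrite -cl_setU1_cl clS (setUidPr _) ?sub1set // cl_id.
rewrite addNr addr0; congr (- _).
rewrite (partition_big (cl M) (hyperplane_avoiding x F)) /=; last first.
  move=> S /andP[/andP[xS /eqP e] nF].
  have xc : x \notin cl M S.
    apply: contra nF => xc; rewrite -e -[cl M (x |: S)]cl_setU1_cl.
    by rewrite (setUidPr _) ?sub1set // clK.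
  rewrite /hyperplane_avoiding cl_flat xc -e cl_mono ?subsetUr //=.
  by rewrite -cl_setU1_cl rk_cl_setU1 // cl_flat.
apply: eq_bigr => G /and4P[fG GF xG /eqP r]; apply: eq_bigl => S.
case: (boolP (cl M S == G)) => [/eqP clS|_]; rewrite ?andbF ?andbT //.
have -> : x \notin S by apply: contra xG; rewrite -clS; apply/subsetP/sub_cl.
rewrite -cl_setU1_cl clS -(flat_eq_cl fG fF) ?r // eqxx /=.
by apply: contraNneq xG => ->.
Qed.

Lemma abs_mobius_rec F x : F \in flats M -> x \in F ->
  abs_mobius F = \sum_(G | hyperplane_avoiding x F G) abs_mobius G.
Proof.
move=> fF xF; rewrite /abs_mobius (mobius_rec fF xF) mulrN mulr_sumr -sumrN.
by apply: eq_bigr => G /and4P[_ _ _ /eqP ->]; rewrite exprS mulN1r mulNr opprK.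
Qed.

Lemma abs_mobius0 : abs_mobius set0 = 1.
Proof.
rewrite /abs_mobius rk0 mul1r /mobius (big_pred1 set0) ?cards0 // => S.
apply/eqP/eqP => [e|->]; last exact: cl0.
by apply/eqP; rewrite -subset0 -e sub_cl.
Qed.

Lemma abs_mobius_gt0 F : F \in flats M -> 0 < abs_mobius F.
Proof.
have [n] := ubnP (rk M F); elim: n F => // n IH F; rewrite ltnS => Fn fF.
have [->|/set0Pn[x xF]] := eqVneq F set0; first by rewrite abs_mobius0.
have pos G : hyperplane_avoiding x F G -> 0 < abs_mobius G.
  by move=> /and4P[fG _ _ /eqP r]; apply: IH; rewrite // -ltnS -r ltnS.
have [G [fG GF xG r]] := exists_corank1_avoiding fF xF.
have hG : hyperplane_avoiding x F G by rewrite /hyperplane_avoiding fG GF xG r eqxx.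
rewrite (abs_mobius_rec fF xF) (bigD1 G) //= ltr_pwDl ?pos // sumr_ge0 // => H /andP[hH _].
exact/ltW/pos.
Qed.

Lemma mu_abs_mobius k : (k <= mrank M)%N ->
  mu M k = \sum_(F | (F \in flats M) && (rk M F == k)) abs_mobius F.
Proof.
move=> kr; rewrite /mu /charpoly coef_sum mulr_sumr.
transitivity (\sum_(S | rk M S == k) (-1) ^+ k * (-1) ^+ #|S| : int).
  rewrite [RHS]big_mkcond; apply: eq_bigr => S _; rewrite coefZ coefXn.
  have -> : (mrank M - k == mrank M - rk M S)%N = (rk M S == k).
    by apply/eqP/eqP => [|->//]; have := rk_le M S; lia.
  by case: eqP => _; rewrite ?mulr1 // !mulr0.
rewrite (partition_big (cl M) (fun F => (F \in flats M) && (rk M F == k))) /=; last first.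
  by move=> S r; rewrite cl_flat rk_cl.
apply: eq_bigr => F /andP[fF /eqP r]; rewrite /abs_mobius r mulr_sumr.
apply: eq_bigl => S; have [clS|_] := eqVneq (cl M S) F; rewrite ?andbF // andbT.
by rewrite -(rk_cl M S) clS r eqxx.
Qed.

Variable e : E.

Definition reduced_mu k : int :=
  \sum_(F | [&& F \in flats M, rk M F == k & e \notin F]) abs_mobius F.

(** This is multiplication by [lambda - 1], read on unsigned coefficients. The flats containing [e]
    are expanded by Weisner's recursion at [e], where each [G] avoiding [e] occurs for exactly one
    of them, [cl M (e |: G)]. *)
Lemma mu_reduced k : (k < mrank M)%N -> mu M k.+1 = reduced_mu k.+1 + reduced_mu k.
Proof.
move=> kr; rewrite mu_abs_mobius // (bigID (fun F : {set E} => e \notin F)) /=.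
congr (_ + _); first by apply: eq_bigl => F; rewrite andbA.
rewrite (eq_bigr (fun F => \sum_(G | hyperplane_avoiding e F G) abs_mobius G)); last first.
  by move=> F /andP[/andP[fF _]]; rewrite negbK => eF; apply: abs_mobius_rec.
rewrite (exchange_big_dep (fun G => [&& G \in flats M, rk M G == k & e \notin G])) /=; last first.
  move=> F G /andP[/andP[_ /eqP rF] _] /and4P[-> _ -> /eqP].
  by rewrite rF => -[->]; rewrite eqxx.
apply: eq_bigr => G /and3P[fG /eqP rG eG].
rewrite (big_pred1 (cl M (e |: G))) // => F /=; rewrite negbK.
apply/andP/eqP => [[/andP[/andP[fF /eqP rF] eF] /and4P[_ GF _ _]]|->].
  by apply: flat_eq_cl; rewrite // rF rG.
rewrite /hyperplane_avoiding cl_flat rk_cl_setU1 // rG !eqxx mem_cl_setU1 fG eG.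
by rewrite sub_cl_setU1.
Qed.

Lemma reduced_mu0 : reduced_mu 0 = 1.
Proof.
rewrite /reduced_mu (big_pred1 set0) ?abs_mobius0 // => F.
apply/and3P/eqP => [[fF /eqP r _]|->]; last by rewrite flats0 rk0 inE.
by apply/esym/(flat_eq_rk (flats0 M) (sub0set _)); rewrite r.
Qed.

Lemma reduced_mu_ge0 k : 0 <= reduced_mu k.
Proof. by apply: sumr_ge0 => F /and3P[fF _ _]; apply/ltW/abs_mobius_gt0. Qed.

Lemma reduced_mu_eq0 k : (mrank M <= k)%N -> reduced_mu k = 0.
Proof.
move=> rk_k; rewrite /reduced_mu big_pred0 // => F; apply/negP => /and3P[fF /eqP r eF].
have : (rk M F < mrank M)%N.
  by apply: rk_proper => //; rewrite properT; apply: contraNneq eF => ->; rewrite inE.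
by rewrite r ltnNge rk_k.
Qed.

Lemma mu0 : mu M 0 = 1.
Proof.
rewrite mu_abs_mobius // (big_pred1 set0) ?abs_mobius0 // => F.
apply/andP/eqP => [[fF /eqP r]|->]; last by rewrite flats0 rk0.
by apply/esym/(flat_eq_rk (flats0 M) (sub0set _)); rewrite r.
Qed.

Lemma reduced_mu_gt0 k : (k < mrank M)%N -> 0 < reduced_mu k.
Proof.
move=> kr.
have [F [fF eF rF]] : exists F, [/\ F \in flats M, e \notin F & rk M F = k].
  (* Descending induction on [k]: start from a flat of corank 1 avoiding [e] and go down one rank at
     a time. *)
  elim: {k}(mrank M - k.+1)%N {-2}k (erefl (mrank M - k.+1)%N) kr => [|n IH] k kn kr.
    have [G [fG _ eG rG]] := exists_corank1_avoiding (flatsT M) (in_setT e).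
    exists G; split=> //; move: rG; rewrite -/(mrank M); lia.
  have [||F [fF eF rF]] := IH k.+1; [by lia|by lia|].
  have /set0Pn[x xF] : F != set0 by apply/eqP => F0; move: rF; rewrite F0 rk0.
  have [G [fG GF _ rG]] := exists_corank1_avoiding fF xF.
  exists G; split=> //; first by apply: contra eF; apply/subsetP.
  by move: rG; rewrite rF => -[].
rewrite /reduced_mu (bigD1 F) ?fF ?rF ?eqxx //= ltr_pwDl ?abs_mobius_gt0 //.
by apply: sumr_ge0 => G /andP[/and3P[fG _ _] _]; apply/ltW/abs_mobius_gt0.
Qed.

End Mobius.

(** * Mixed degrees of alpha and beta *)

Section IntersectionNumbers.
Variables (E : finType) (M : matroid E) (e : E).
Implicit Types (s : {set {set E}}) (F G B T : {set E}) (x : E).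

Notation d := (flag_dim M).
Notation fan := (bergman_fan rat M).
Notation deg := (deg fan).
Notation flag := (flag M).
Notation lk := (link flag).
Notation "'alpha'" := (pencil_in rat e).
Notation "'beta'" := (pencil_out rat e).

Lemma flag_card_le s lo hi : flag s ->
  {in s, forall F, (lo <= rk M F <= hi)%N} -> (#|s| <= hi.+1 - lo)%N.
Proof.
move=> fs bnd; rewrite cardE -(size_map (rk M)) -[leqRHS](size_iota lo).
apply: uniq_leq_size.
  rewrite map_inj_in_uniq ?enum_uniq // => F G; rewrite !mem_enum => Fs Gs r.
  by apply/eqP; rewrite eqEsubset !(flag_sub_rk fs) // r leqnn.
move=> i /mapP[F]; rewrite mem_enum => Fs ->; rewrite mem_iota.
by have /andP[h1 h2] := bnd F Fs; rewrite h1 subnKC ?ltnS // (leq_trans h1) // leqW.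
Qed.

Lemma deg_alpha_cons vs s x : flag s -> (#|s| + (size vs).+1)%N = d ->
  (forall F, F \in s -> x \notin F) ->
  deg (alpha :: vs) s = \sum_(F | lk s F && (x \in F)) deg vs (F |: s).
Proof.
move=> fs sd xs; rewrite (@deg_reduced _ _ fan _ _ _ (pencil_in rat x)) //.
- by rewrite [RHS]big_mkcondr; apply: eq_bigr => F _; rewrite ffunE; case: ifP; rewrite ?mul1r ?mul0r.
- exact: pencil_in_modular.
- by move=> F Fs; rewrite ffunE (negPf (xs F Fs)).
Qed.

Lemma deg_beta_cons vs s x : flag s -> (#|s| + (size vs).+1)%N = d ->
  (forall F, F \in s -> x \in F) ->
  deg (beta :: vs) s = \sum_(F | lk s F && (x \notin F)) deg vs (F |: s).
Proof.
move=> fs sd xs; rewrite (@deg_reduced _ _ fan _ _ _ (pencil_out rat x)) //.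
- by rewrite [RHS]big_mkcondr; apply: eq_bigr => F _; rewrite ffunE; case: ifP; rewrite ?mul1r ?mul0r.
- exact: pencil_out_modular.
- by move=> F Fs; rewrite ffunE (xs F Fs).
Qed.

(** With the element chosen outside the top flat [T], alpha adds flats only above [T], so a rank
    missing below [T] is never filled and the degree is 0. If none is missing, the only contributing
    choice at each step is [cl M (x |: T)]. *)
Lemma deg_alpha m s T : flag s -> (#|s| + m)%N = d ->
  (T == set0) || (T \in s) -> (forall F, F \in s -> F \subset T) ->
  deg (nseq m alpha) s = (rk M T == #|s|)%:R.
Proof.
elim: m s T => [|m IH] s T fs sd Ts Tmax.
  have [Ts'|nTs] := boolP (T \in s).
    have /flagP[/(_ T Ts')/proper_flat_rk/andP[_ Td] _] := fs.
    rewrite /=; apply/esym/eqP; rewrite pnatr_eq1 eqb1 eqn_leq -{1}[#|s|]addn0 sd Td /=.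
    have : (#|s| <= (rk M T).+1 - 1)%N.
      apply: flag_card_le => // F Fs; rewrite rk_mono ?Tmax // andbT.
      by have /flagP[/(_ F Fs)/proper_flat_rk/andP[r _] _] := fs.
    by rewrite subn1.
  move: Ts; rewrite (negPf nTs) orbF => /eqP T0; subst T.
  have s0 : s = set0.
    apply/eqP; rewrite -subset0; apply/subsetP => F Fs.
    have /flagP[/(_ F Fs)/and3P[_ /negP[]]] := fs.
    by rewrite -subset0 Tmax.
  by rewrite /= s0 cards0 rk0 eqxx.
have fT : T \in flats M.
  by case/orP: Ts => [/eqP->|/(flag_flat fs)//]; apply: flats0.
have Td : (T != setT).
  case/orP: Ts => [/eqP->|Ts]; first by apply/eqP => /setP/(_ e); rewrite !inE.
  by have /flagP[/(_ T Ts)/and3P[]] := fs.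
have [x _ xT] : exists2 x, x \in [set: E] & x \notin T by apply/subsetPn; rewrite subTset.
have xs F : F \in s -> x \notin F by move=> /Tmax/subsetP FT; apply: contra xT; apply: FT.
rewrite (deg_alpha_cons (x := x)) ?size_nseq //.
have sub F : lk s F -> x \in F -> forall G, G \in s -> G \subset F.
  move=> lF xF G Gs; have [_ _ /(_ G Gs) /orP[/subsetP FG|//]] := lkP _ fs lF.
  by have := xs G Gs; rewrite FG.
have TF F : lk s F -> x \in F -> T \subset F.
  by move=> lF xF; case/orP: Ts => [/eqP->|Ts]; [apply: sub0set | apply: sub].
rewrite (eq_bigr (fun F => (rk M F == #|s|.+1)%:R)) => [|F /andP[lF xF]]; last first.
  rewrite (IH _ F) ?(lk_card lF) ?addSnnS ?setU11 ?orbT //; first by case/andP: lF.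
  by move=> G; rewrite inE => /orP[|/(sub F lF xF)//]; rewrite inE => /eqP->.
have cT : (#|s| <= rk M T)%N.
  have := @flag_card_le s 1 (rk M T) fs; rewrite subn1; apply=> F Fs.
  rewrite rk_mono ?Tmax // andbT.
  by have /flagP[/(_ F Fs)/proper_flat_rk/andP[r _] _] := fs.
have [rT|rT] := eqVneq (rk M T) #|s|; last first.
  rewrite big1 // => F /andP[lF xF]; case: eqP => // rF; case/negP: rT.
  rewrite eqn_leq cT andbT -ltnS -rF rk_proper //.
  by apply/properP; split; [apply: TF | exists x].
have lx : lk s (cl M (x |: T)).
  apply/(lkP _ fs); split.
  - by apply/negP => /xs; rewrite mem_cl_setU1.
  - have r : rk M (cl M (x |: T)) = #|s|.+1 by rewrite rk_cl_setU1 // rT.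
    rewrite /proper_flat cl_flat /=; apply/andP; split; apply/eqP => c; move: r.
      by rewrite c rk0.
    by rewrite c -/(mrank M) => r; move: sd; rewrite /flag_dim r /=; lia.
  - by move=> H /Tmax HT; rewrite (subset_trans HT) ?sub_cl_setU1 // orbT.
rewrite (bigD1 (cl M (x |: T))) ?lx ?mem_cl_setU1 //=.
rewrite rk_cl_setU1 // rT eqxx big1 ?addr0 // => F /andP[/andP[lF xF] nF].
case: eqP => // rF; case/eqP: nF.
by apply: flat_eq_cl => //; [exact: lk_flat lF | exact: TF | rewrite rF rT].
Qed.

(** With its element in the bottom flat [B], beta adds flats only below [B], and alpha then requires
    every rank up to that of [T] to be filled. The sum over [G] has the shape of [abs_mobius_rec],
    so that one more step collapses it to [abs_mobius M F]. *)
Lemma deg_beta_alpha k m s B T x : flag s -> (#|s| + (k + m))%N = d ->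
  B \in s -> T \in s -> (forall F, F \in s -> (B \subset F) && (F \subset T)) -> x \in B ->
  deg (nseq k beta ++ nseq m alpha) s = (rk M T == #|s| + k)%N%:R *
    (\sum_(G | [&& G \in flats M, G \subset B, x \notin G & rk M G == k]) abs_mobius M G)%:~R.
Proof.
elim: k s B x => [|k IH] s B x fs sd Bs Ts BT xB.
  rewrite cat0s (deg_alpha (T := T)) ?Ts ?orbT //; last by move=> F /BT/andP[].
  rewrite addn0 (big_pred1 set0) ?abs_mobius0 ?mulr1 // => G.
  apply/and4P/eqP => [[fG _ _ /eqP r]|->]; last by rewrite flats0 sub0set inE rk0.
  by apply/esym/(flat_eq_rk (flats0 M) (sub0set _)); rewrite r.
have xs F : F \in s -> x \in F by move=> /BT/andP[/subsetP BF _]; apply: BF.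
rewrite cat_cons (deg_beta_cons (x := x)) //; last by rewrite size_cat !size_nseq -addSn.
have sub F : lk s F -> x \notin F -> forall G, G \in s -> F \subset G.
  move=> lF xF G Gs; have [_ _ /(_ G Gs) /orP[//|/subsetP GF]] := lkP _ fs lF.
  by rewrite GF ?xs in xF.
have step F : lk s F -> x \notin F -> forall y, y \in F ->
  deg (nseq k beta ++ nseq m alpha) (F |: s) = (rk M T == #|s| + k.+1)%N%:R *
    (\sum_(G | [&& G \in flats M, G \subset F, y \notin G & rk M G == k]) abs_mobius M G)%:~R.
  move=> lF xF y yF; rewrite (IH (F |: s) F y) ?setU11 ?(lk_card lF) ?addSnnS //.
  - by case/andP: lF.
  - by rewrite inE Ts orbT.
  - move=> G; rewrite inE => /orP[|Gs]; first by rewrite inE => /eqP->; rewrite subxx sub.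
    by rewrite sub //; case/andP: (BT G Gs).
have ne F : lk s F -> exists y, y \in F.
  by move=> /(lkP _ fs)[_ /and3P[_ /set0Pn]].
have [rT|nrT] := eqVneq (rk M T) (#|s| + k.+1)%N; last first.
  rewrite mul0r big1 // => F /andP[lF xF]; have [y yF] := ne F lF.
  by rewrite (step F lF xF y yF) (negPf nrT) mul0r.
rewrite mul1r.
(* Only rank [k.+1] contributes: a smaller rank leaves no [G] of rank [k] avoiding [y], and for a
   larger one the interval from [F] to [T] is too short for the flag, by [flag_card_le]. *)
have inner F : lk s F -> x \notin F -> deg (nseq k beta ++ nseq m alpha) (F |: s) =
    if rk M F == k.+1 then (abs_mobius M F)%:~R else 0.
  move=> lF xF; have [y yF] := ne F lF; have fF := lk_flat fs lF.
  rewrite (step F lF xF y yF) rT eqxx mul1r; case: eqP => rF.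
    rewrite (abs_mobius_rec fF yF); congr (_%:~R); apply: eq_bigl => G.
    by rewrite /hyperplane_avoiding rF eqSS [k == _]eq_sym.
  rewrite big_pred0 // => G; apply/negP => /and4P[fG GF yG /eqP rG].
  have rFG : (k < rk M F)%N.
    by rewrite -rG; apply: rk_proper => //; apply/properP; split=> //; exists y.
  have flF : flag (F |: s) by case/andP: lF.
  have := @flag_card_le (F |: s) (rk M F) (rk M T) flF; rewrite (lk_card lF) rT => h.
  have {}h : (#|s|.+1 <= (#|s| + k.+1).+1 - rk M F)%N.
    apply: h => H; rewrite inE => /orP[|Hs].
      by rewrite inE => /eqP->; rewrite leqnn -rT rk_mono ?sub.
    by rewrite rk_mono ?sub // -rT rk_mono //; case/andP: (BT H Hs).
  by apply: rF; clear -h rFG; lia.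
rewrite (eq_bigr (fun F => if rk M F == k.+1 then (abs_mobius M F)%:~R else 0)) => [|F /andP[lF xF]]; last exact: inner.
rewrite -big_mkcondr rmorph_sum /=; apply: eq_bigl => F.
apply/andP/and4P => [[/andP[lF xF] rF]|[fF FB xF rF]].
  by split=> //; [exact: lk_flat lF | exact: sub].
split=> //; rewrite xF andbT; apply/(lkP _ fs).
have /flagP[/(_ B Bs) pB _] := fs.
split.
- by apply: contra xF; apply: xs.
- apply: (@proper_flat_between _ _ _ set0 B) => //.
    by rewrite proper0; apply/eqP => F0; move: rF; rewrite F0 rk0.
  by apply/properP; split=> //; exists x.
- by move=> H /BT/andP[BH _]; rewrite (subset_trans FB BH).
Qed.

(** The empty flag has no bottom flat, so the first beta keeps its own element [e], which selects
    the flats avoiding [e]; [deg_beta_alpha] applies to the flag of one flat that results. *)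
Lemma deg_reduced_mu k m : (k + m)%N = d ->
  deg (nseq k beta ++ nseq m alpha) set0 = (reduced_mu M e k)%:~R.
Proof.
case: k => [|k] km.
  rewrite cat0s (deg_alpha (T := set0)) ?flag0 ?cards0 ?eqxx //.
    by rewrite rk0 reduced_mu0.
  by move=> F; rewrite inE.
rewrite cat_cons (deg_beta_cons (x := e)) ?flag0 //; first last.
- by move=> F; rewrite inE.
- by rewrite cards0 size_cat !size_nseq -addSn.
rewrite /reduced_mu rmorph_sum /=.
rewrite (eq_bigr (fun F => if rk M F == k.+1 then (abs_mobius M F)%:~R else 0)) => [|F /andP[lF eF]]; last first.
  have [_ /and3P[fF /set0Pn[y yF] _] _] := lkP _ (flag0 M) lF.
  have flF : flag (F |: set0) by case/andP: lF.
  rewrite (@deg_beta_alpha _ _ _ F F y) ?setU11 ?(lk_card lF) ?cards0 //.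
  - case: eqP => rF; last by rewrite mul0r.
    rewrite mul1r (abs_mobius_rec fF yF); congr (_%:~R); apply: eq_bigl => G.
    by rewrite /hyperplane_avoiding rF add1n eqSS [k == _]eq_sym.
  - by move=> G; rewrite !inE orbF => /eqP->; rewrite subxx.
rewrite -big_mkcondr; apply: eq_bigl => F.
apply/andP/and3P => [[/andP[lF eF] rF]|[fF rF eF]].
  by split=> //; exact: lk_flat (flag0 M) lF.
split=> //; rewrite eF andbT; apply/(lkP _ (flag0 M)); split; rewrite ?inE //; last first.
  by move=> H; rewrite inE.
apply/and3P; split=> //; first by apply/eqP => F0; move: rF; rewrite F0 rk0.
by apply: contraNneq eF => ->; rewrite inE.
Qed.

Theorem reduced_mu_log_concave k : (k.+2 <= d)%N ->
  reduced_mu M e k * reduced_mu M e k.+2 <= reduced_mu M e k.+1 ^+ 2.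
Proof.
move=> kd; pose m := (d - k.+2)%N.
pose vs := nseq k beta ++ nseq m alpha.
have sz : size vs = (k + m)%N by rewrite size_cat !size_nseq.
have f0 : flag set0 by apply: flag0.
have aa : deg (alpha :: alpha :: vs) set0 = (reduced_mu M e k)%:~R.
  rewrite -(@deg_reduced_mu k m.+2); last by rewrite /m; lia.
  rewrite (@deg_move _ _ fan (nseq k beta) alpha (alpha :: nseq m alpha)) //; last first.
    by rewrite cards0 /= !size_nseq /m; lia.
  rewrite -cat_cons (@deg_move _ _ fan (alpha :: nseq k beta) alpha (nseq m alpha)) //.
  by rewrite cards0 /= !size_nseq /m; lia.
have ab : deg (alpha :: beta :: vs) set0 = (reduced_mu M e k.+1)%:~R.
  rewrite -(@deg_reduced_mu k.+1 m.+1); last by rewrite /m; lia.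
  rewrite (@deg_move _ _ fan (nseq k.+1 beta) alpha (nseq m alpha)) //.
  by rewrite cards0 !size_nseq /m /=; lia.
have bb : deg (beta :: beta :: vs) set0 = (reduced_mu M e k.+2)%:~R.
  by rewrite -(@deg_reduced_mu k.+2 m) //; rewrite /m; lia.
rewrite -(ler_int rat) rmorphM rmorphXn /= -aa -ab -bb.
apply: (@nef_log_concave _ _ fan (flag_link_nonempty (M := M)) _ _ (crossing_pairs rat E)) => //.
- by move=> s fs sd f fadj; apply: flag_link_connected fadj.
- exact: flag_surface_negative.
- exact: crossing_pairs_ample.
- by rewrite cards0 sz /m /=; lia.
- by move=> w; rewrite mem_cat !mem_nseq => /orP[]/andP[_ /eqP->]; [apply: pencil_out_nef | apply: pencil_in_nef].
- exact: pencil_out_nef.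
Qed.

End IntersectionNumbers.

(** * From the reduced sequence to the full one, and unimodality *)

(** The extra inequality [x0 * x3 <= x1 * x2] comes from multiplying the two hypotheses and
    cancelling [x1 * x2 > 0]. *)
Lemma log_concave_convolution1 (R : realDomainType) (x0 x1 x2 x3 : R) :
  0 <= x0 -> 0 < x1 -> 0 < x2 -> 0 <= x3 ->
  x0 * x2 <= x1 ^+ 2 -> x1 * x3 <= x2 ^+ 2 ->
  (x1 + x0) * (x3 + x2) <= (x2 + x1) ^+ 2.
Proof.
move=> p0 p1 p2 p3 h1 h2.
have x12 : 0 < x1 * x2 by rewrite mulr_gt0.
have h3 : x0 * x3 <= x1 * x2.
  rewrite -(ler_pM2r x12).
  have -> : x0 * x3 * (x1 * x2) = (x0 * x2) * (x1 * x3) by ring.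
  have -> : x1 * x2 * (x1 * x2) = x1 ^+ 2 * x2 ^+ 2 by ring.
  by apply: ler_pM => //; rewrite mulr_ge0 // ltW.
have -> : (x1 + x0) * (x3 + x2) = x1 * x3 + x0 * x2 + (x0 * x3 + x1 * x2) by ring.
have -> : (x2 + x1) ^+ 2 = x2 ^+ 2 + x1 ^+ 2 + (x1 * x2 + x1 * x2) by ring.
by rewrite !lerD.
Qed.

(** [k] is the first index at which the sequence stops increasing strictly. Log-concavity and
    positivity make a weak descent propagate to all later indices. *)
Lemma log_concave_unimodal (R : realDomainType) (c : nat -> R) (r : nat) :
  (forall a, (a <= r)%N -> 0 < c a) ->
  (forall a, (a.+2 <= r)%N -> c a * c a.+2 <= c a.+1 ^+ 2) ->
  exists k, [/\ (k <= r)%N, forall a, (a < k)%N -> c a <= c a.+1 &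
    forall a, (k <= a < r)%N -> c a.+1 <= c a].
Proof.
move=> pos lc; pose stop k := (r <= k)%N || (c k.+1 <= c k).
have ex : exists k, stop k by exists r; rewrite /stop leqnn.
case: (ex_minnP ex) => k sk kmin; exists k; split.
- by apply: kmin; rewrite /stop leqnn.
- move=> a ak; rewrite leNgt; apply/negP => ca.
  by have := kmin a; rewrite /stop (ltW ca) orbT leqNgt ak => /(_ isT).
elim=> [|a IH] /andP[ka ar].
  by move: sk; move: ka; rewrite leqn0 => /eqP->; rewrite /stop leqNgt ar.
move: ka; rewrite leq_eqVlt => /predU1P[e|ka].
  by move: sk; rewrite e /stop leqNgt ar.
have dec : c a.+1 <= c a by apply: IH; rewrite -ltnS ka ltnW.
have ca : 0 < c a by apply: pos; rewrite ltnW // ltnW.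
rewrite -(ler_pM2l ca); apply: le_trans (lc a ar) _.
by rewrite expr2 ler_wpM2r // ltW // pos // ltnW.
Qed.

Section CharacteristicPolynomial.
Variables (E : finType) (M : matroid E).

Lemma mrank_gt0 (e : E) : (0 < mrank M)%N.
Proof.
rewrite -(rk0 M) rk_proper ?flats0 // proper0; apply/eqP => /setP/(_ e).
by rewrite !inE.
Qed.

Lemma mu_gt0 k : (k <= mrank M)%N -> 0 < mu M k.
Proof.
case: k => [|k] kr; first by rewrite mu0.
have [e _|E0] := pickP (fun _ : E => true).
  by rewrite (mu_reduced e) // ltr_wpDl ?reduced_mu_ge0 ?reduced_mu_gt0.
suff e : [set: E] = set0 by move: kr; rewrite /mrank e rk0.
by apply/setP => x; have := E0 x.
Qed.

Lemma mu_log_concave k : (k.+2 <= mrank M)%N -> mu M k * mu M k.+2 <= mu M k.+1 ^+ 2.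
Proof.
move=> kr; have [e _|E0] := pickP (fun _ : E => true); last first.
  suff e : [set: E] = set0 by move: kr; rewrite /mrank e rk0.
  by apply/setP => x; have := E0 x.
have lc i : reduced_mu M e i * reduced_mu M e i.+2 <= reduced_mu M e i.+1 ^+ 2.
  have [id|di] := leqP i.+2 (flag_dim M); first exact: reduced_mu_log_concave.
  rewrite (@reduced_mu_eq0 _ _ _ i.+2) ?mulr0 ?sqr_ge0 //.
  by move: di; rewrite /flag_dim; have := mrank_gt0 e; case: (mrank M).
have ge0 := reduced_mu_ge0 M e.
(* At the first index, [mu M 0 = 1] is [reduced_mu M e 0] plus a preceding coefficient taken to be
   0. *)
case: k kr => [|k] kr.
  have := lc 0%N; rewrite !(mu_reduced e) ?(ltnW kr) // mu0 (reduced_mu0 M e).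
  have := @log_concave_convolution1 _ 0 1 (reduced_mu M e 1) (reduced_mu M e 2).
  rewrite addr0 mul0r => h l0; apply: h; rewrite ?ltr01 ?sqr_ge0 ?ge0 //.
  exact: reduced_mu_gt0.
rewrite !(mu_reduced e) //; try by lia.
by apply: log_concave_convolution1; rewrite ?ge0 ?lc // reduced_mu_gt0 //; lia.
Qed.

End CharacteristicPolynomial.

Theorem mainTheorem4 (E : finType) (M : matroid E) :
  (forall a : nat, (a <= mrank M)%N -> 0 <= mu M a) /\
  (exists k : nat,
     [/\ (k <= mrank M)%N,
         forall a : nat, (a < k)%N -> mu M a <= mu M a.+1 &
         forall a : nat, (k <= a < mrank M)%N -> mu M a.+1 <= mu M a]) /\
  (forall k : nat, (1 <= k < mrank M)%N ->
     mu M k.-1 * mu M k.+1 <= mu M k ^+ 2).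
Proof.
split; first by move=> a /mu_gt0/ltW.
split.
  by apply: log_concave_unimodal => a; [apply: mu_gt0 | apply: mu_log_concave].
by case=> // k /andP[_]; apply: mu_log_concave.
Qed.
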